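(* Let $(Z,\mathcal A,\nu,U)$ be a non-atomic measure-preserving automorphism of a standard Borel probability space. Then it is metrically equivalent to a countable interval exchange transformation.
   Context: An automorphism $U$ of $(Z,\mathcal A,\nu)$ is a bimeasurable, measure-preserving bijection of $Z$; non-atomic means $\nu$ has no atoms. Countable interval exchange transformation (countable IET): a measurable map $R:[0,1]\to[0,1]$ for which there is a countable family of pairwise disjoint open intervals $\{U_m\}$ whose union has full Lebesgue measure, and constants $d_m$, such that $R(u)=u+d_m$ for almost every $u\in U_m$, while the translated intervals $U_m+d_m$ are contained in $[0,1]$ up to endpoints, are pairwise disjoint modulo endpoints, and cover $[0,1]$ modulo a Lebesgue-null set. A countable IET is regarded as a measure-preserving system with Lebesgue measure on $[0,1]$. Metric equivalence: measure-preserving systems $(X,\mathcal B_X,\mu,S)$ and $(Y,\mathcal B_Y,\nu,T)$ on standard Borel probability spaces are metrically equivalent if there exist invariant full-measure sets $X_0\subset X$, $Y_0\subset Y$ and a measurable bijection $\Phi:X_0\to Y_0$ with measurable inverse such that $\Phi_*\mu=\nu$ and $\Phi\circ S=T\circ\Phi$ on $X_0$. *)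

(* Defs.v *)
From HB Require Import structures.
From mathcomp Require Import all_boot all_order all_algebra.
From mathcomp Require Import all_classical all_reals all_analysis.

Set Implicit Arguments.
Unset Strict Implicit.
Unset Printing Implicit Defensive.

Import Order.TTheory GRing.Theory Num.Theory.
Import numFieldNormedType.Exports.

Local Open Scope classical_set_scope.
Local Open Scope ring_scope.

Definition polish (R : realType) (P : metricType R) : Prop :=
  (forall F : set_system P, ProperFilter F -> cauchy F ->
     exists p : P, F --> p) /\
  (exists2 D : set P, countable D & dense D).

(* The sigma-algebra of Z is, up to a bijection of the underlying points, the
   Borel sigma-algebra of a Polish space. *)
Definition standard_borel (R : realType) d (Z : measurableType d) : Prop :=
  exists (P : metricType R) (f : Z -> P),
    [/\ polish P,
        bijective f &
        forall A : set Z, measurable A <-> <<s @open P >> (f @` A)].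

Definition is_atom (R : realType) d (Z : measurableType d)
    (nu : {measure set Z -> \bar R}) (A : set Z) : Prop :=
  [/\ measurable A,
      (0 < nu A)%E &
      forall B : set Z, measurable B -> B `<=` A ->
        nu B = 0%E \/ nu B = nu A].

Definition non_atomic (R : realType) d (Z : measurableType d)
    (nu : {measure set Z -> \bar R}) : Prop :=
  forall A : set Z, ~ is_atom nu A.

Definition automorphism (R : realType) d (Z : measurableType d)
    (nu : {measure set Z -> \bar R}) (U : Z -> Z) : Prop :=
  [/\ measurable_fun setT U,
      exists V : Z -> Z,
        [/\ cancel U V, cancel V U & measurable_fun setT V] &
      forall A : set Z, measurable A -> nu (U @^-1` A) = nu A].

(* In the next two definitions a system consists of a carrier D (a measurable
   subset of the ambient type), the restriction to D of a measure on the
   ambient type, and a map sending D to itself; the values of the map outside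
   D are irrelevant.  This is how [0, 1] with Lebesgue measure is handled. *)
Definition invariant_full (R : realType) d (X : measurableType d)
    (D : set X) (mu : {measure set X -> \bar R}) (S : X -> X)
    (X0 : set X) : Prop :=
  [/\ measurable X0,
      X0 `<=` D,
      mu (D `\` X0) = 0%E &
      D `&` S @^-1` X0 = X0].

Definition metrically_equivalent (R : realType)
    dX (X : measurableType dX) (DX : set X)
    (mu : {measure set X -> \bar R}) (S : X -> X)
    dY (Y : measurableType dY) (DY : set Y)
    (nu : {measure set Y -> \bar R}) (T : Y -> Y) : Prop :=
  exists (X0 : set X) (Y0 : set Y) (Phi : X -> Y) (Psi : Y -> X),
    [/\ invariant_full DX mu S X0 /\ invariant_full DY nu T Y0,
        set_fun X0 Y0 Phi /\ set_fun Y0 X0 Psi,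
        {in X0, cancel Phi Psi} /\ {in Y0, cancel Psi Phi},
        measurable_fun X0 Phi /\ measurable_fun Y0 Psi &
        (forall B : set Y, measurable B -> B `<=` Y0 ->
           mu (X0 `&` Phi @^-1` B) = nu B) /\
        (forall x, X0 x -> Phi (S x) = T (Phi x))].

(* The family of open intervals is indexed by nat; `]a m, b m[ is empty when
   b m <= a m, so finite families are included.  Open intervals do not contain
   their endpoints, so containment and disjointness up to endpoints are plain
   containment and disjointness. *)
Definition countable_iet (R : realType) (T : R -> R) : Prop :=
  let I01 : set R := `[0, 1]%classic in
  [/\ set_fun I01 I01 T,
      measurable_fun I01 T &
      exists a b d : nat -> R,
        let U (m : nat) : set R := `]a m, b m[%classic in
        let V (m : nat) : set R := [set u + d m | u in U m] in
        [/\ (forall m, U m `<=` I01) /\ (forall m, V m `<=` I01),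
            trivIset setT U /\ trivIset setT V,
            (@lebesgue_measure R) (I01 `\` \bigcup_m U m) = 0%E,
            (@lebesgue_measure R) (I01 `\` \bigcup_m V m) = 0%E &
            forall m, {ae (@lebesgue_measure R),
                         forall u, U m u -> T u = u + d m}]].

(* Main.v *)
(** The Arnoux-Ornstein-Weiss argument.  Fix a countable family of sets A_n that
    separates points.  A decreasing sequence of marker sets B_n, each met
    infinitely often in both directions by every orbit, is chosen so that almost
    every orbit meets their intersection at most once.  The visits to B_n cut
    every orbit into finite blocks, and the label of x at stage n records the
    position of x in its block together with the earlier data along the block.
    A cell (a set of points with a common label) is mapped by U onto a cell as
    long as U stays in the block, and almost every x stays in its block from
    some stage on.

    Order the points lexicographically by a code whose (n+1)st digit is the
    label, at stage n+1, of the point where the stage-n block of x starts.  This digit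
    does not change inside the block, so U preserves the order inside a cell.
    The map Phi x = nu {y | y < x} has uniform law because points are null, it
    sends cells to intervals up to endpoints, and it turns U into a translation
    on each cell inside which U stays in the block.  Completeness of the Polish
    model serves only to build a Borel left inverse of Phi almost everywhere. *)

Require Import Defs.
From HB Require Import structures.
From mathcomp Require Import all_boot all_order all_algebra.
From mathcomp Require Import all_classical all_reals all_analysis.
From mathcomp Require Import ring lra.

Set Implicit Arguments.
Unset Strict Implicit.
Unset Printing Implicit Defensive.

Import Order.TTheory GRing.Theory Num.Theory.
Import numFieldNormedType.Exports.

Local Open Scope classical_set_scope.
Local Open Scope ring_scope.

(** * Countably valued measurable functions *)

Section MeasurablePredicates.
Context d (Z : measurableType d).
Implicit Types P Q : Z -> Prop.

Lemma measurable_const (P : Prop) : measurable [set _ : Z | P].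
Proof.
case: (pselect P) => p.
  by rewrite (_ : [set _ | P] = setT)//; apply/seteqP; split.
by rewrite (_ : [set _ | P] = set0)//; apply/seteqP; split.
Qed.

Lemma measurable_not P : measurable [set x | P x] -> measurable [set x | ~ P x].
Proof. exact: measurableC. Qed.

Lemma measurable_and P Q : measurable [set x | P x] ->
  measurable [set x | Q x] -> measurable [set x | P x /\ Q x].
Proof. exact: measurableI. Qed.

Lemma measurable_imply P Q : measurable [set x | P x] ->
  measurable [set x | Q x] -> measurable [set x | P x -> Q x].
Proof.
move=> mP mQ; rewrite (_ : [set x | _] = ~` [set x | P x] `|` [set x | Q x]).
  by apply: measurableU => //; exact: measurableC.
apply/seteqP; split => x /=; last by case.
by move=> PQ; case: (pselect (P x)) => [/PQ|]; [right|left].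
Qed.

Lemma measurable_iff P Q : measurable [set x | P x] ->
  measurable [set x | Q x] -> measurable [set x | P x <-> Q x].
Proof. by move=> mP mQ; apply: measurable_and; exact: measurable_imply. Qed.

Lemma measurable_exists (I : countType) (P : I -> Z -> Prop) :
  (forall i, measurable [set x | P i x]) -> measurable [set x | exists i, P i x].
Proof.
move=> mP; rewrite (_ : [set x | _] = \bigcup_i [set x | P i x]).
  apply: countable_bigcupT_measurable mP; exact: countableP.
by apply/seteqP; split => x /= [i]; [exists i|move=> _ ?; exists i].
Qed.

Lemma measurable_forall (I : countType) (P : I -> Z -> Prop) :
  (forall i, measurable [set x | P i x]) -> measurable [set x | forall i, P i x].
Proof.
move=> mP; rewrite (_ : [set x | _] = ~` [set x | exists i, ~ P i x]).
  by apply/measurableC/measurable_exists => i; exact: measurable_not.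
apply/seteqP; split => x /=; first by move=> h [i]; apply.
by move=> h i; apply: contrapT => ?; apply: h; exists i.
Qed.

End MeasurablePredicates.

(** Measurability for the discrete sigma-algebra on [T]; countability of [T] makes the fibres a
    sufficient test. *)
Definition measurable_fibers d (Z : measurableType d) (T : countType)
  (f : Z -> T) := forall t, measurable [set x | f x = t].

Section MeasurableFibers.
Context d (Z : measurableType d).
Implicit Types T : countType.

Lemma measurable_fibers_preimage T (f : Z -> T) (P : T -> Prop) :
  measurable_fibers f -> measurable [set x | P (f x)].
Proof.
move=> mf; rewrite (_ : [set x | _] = [set x | exists t, P t /\ f x = t]).
  by apply: measurable_exists => t; apply: measurable_and => //;
    exact: measurable_const.
by apply/seteqP; split => x /=; [exists (f x)|case=> t [? ->]].
Qed.

Lemma measurable_fibers_comp T T' (g : T -> T') (f : Z -> T) :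
  measurable_fibers f -> measurable_fibers (fun x => g (f x)).
Proof.
move=> mf t; exact: (measurable_fibers_preimage (fun u => g u = t) mf).
Qed.

Lemma measurable_fibers_precomp T (f : Z -> T) (g : Z -> Z) :
  measurable_fun setT g -> measurable_fibers f ->
  measurable_fibers (fun x => f (g x)).
Proof.
by move=> mg mf t; have := mg measurableT _ (mf t); rewrite setTI.
Qed.

Lemma measurable_fibers_cst T (t : T) : measurable_fibers (fun _ : Z => t).
Proof. by move=> u; exact: measurable_const. Qed.

Lemma measurable_fibers_pair T T' (f : Z -> T) (g : Z -> T') :
  measurable_fibers f -> measurable_fibers g ->
  measurable_fibers (fun x => (f x, g x)).
Proof.
move=> mf mg [t u].
rewrite (_ : [set x | _] = [set x | f x = t /\ g x = u]).
  by apply: measurable_and; [exact: mf|exact: mg].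
by apply/seteqP; split => x /= [-> ->].
Qed.

Lemma measurable_fibers_asbool (P : Z -> Prop) :
  measurable [set x | P x] -> measurable_fibers (fun x => `[< P x >]).
Proof.
move=> mP [].
  rewrite (_ : [set x | _] = [set x | P x])//.
  by apply/seteqP; split => x /=; case: asboolP.
rewrite (_ : [set x | _] = [set x | ~ P x]); first exact: measurable_not.
by apply/seteqP; split => x /=; case: asboolP.
Qed.

(** Maps are glued along a countable measurable partition; this evaluates a sequence of maps at an
    index that itself depends on the point. *)
Lemma measurable_fibers_select T T' (k : Z -> T) (F : T -> Z -> T') :
  measurable_fibers k -> (forall t, measurable_fibers (F t)) ->
  measurable_fibers (fun x => F (k x) x).
Proof.
move=> mk mF u.
rewrite (_ : [set x | _] = [set x | exists t, k x = t /\ F t x = u]).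
  by apply: measurable_exists => t; apply: measurable_and; [exact: mk|exact: mF].
by apply/seteqP; split => x /=; [exists (k x)|case=> t [-> ]].
Qed.

Lemma measurable_fun_select d' (Y : measurableType d') T (k : Z -> T)
    (F : T -> Z -> Y) :
  measurable_fibers k -> (forall t, measurable_fun setT (F t)) ->
  measurable_fun setT (fun x => F (k x) x).
Proof.
move=> mk mF _ B mB; rewrite setTI.
rewrite (_ : _ @^-1` B = [set x | exists t, k x = t /\ B (F t x)]).
  apply: measurable_exists => t; apply: measurable_and => //.
  by have := mF t measurableT B mB; rewrite setTI.
by apply/seteqP; split => x /=; [exists (k x)|case=> t [-> ]].
Qed.

Lemma measurable_fibers_map T (F : nat -> Z -> T) (s : seq nat) :
  (forall j, measurable_fibers (F j)) ->
  measurable_fibers (fun x => [seq F j x | j <- s]).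
Proof.
move=> mF; elim: s => [|j s IH]; first exact: measurable_fibers_cst.
have := measurable_fibers_pair (mF j) IH.
exact: (measurable_fibers_comp (fun p => p.1 :: p.2)).
Qed.

End MeasurableFibers.

(** * First hitting times *)

Section FirstTime.
Local Open Scope nat_scope.

(** The default 0 keeps the index total, so ages and block lengths can be defined before recurrence
    is known. *)
Definition first_index (P : nat -> Prop) : nat :=
  if pselect (exists j, `[< P j >]) is left e then ex_minn e else 0.

Lemma first_indexP (P : nat -> Prop) : (exists j, P j) ->
  P (first_index P) /\ forall i, i < first_index P -> ~ P i.
Proof.
case=> j Pj; rewrite /first_index; case: pselect => [e|[]]; last first.
  by exists j; apply/asboolP.
case: ex_minnP => m /asboolP Pm mmin; split => // i im Pi.
by have := mmin i (asboolT Pi); rewrite leqNgt im.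
Qed.

Lemma first_index_eq (P : nat -> Prop) j : P j -> (forall i, i < j -> ~ P i) ->
  first_index P = j.
Proof.
move=> Pj jmin; have [] := @first_indexP P; first by exists j.
move=> Pf fmin; case: (ltngtP (first_index P) j) => // [/jmin//|/fmin//].
Qed.

Lemma measurable_fibers_first_index d (Z : measurableType d) (Q : nat -> Z -> Prop) :
  (forall x, exists j, Q j x) -> (forall j, measurable [set x | Q j x]) ->
  measurable_fibers (fun x => first_index (fun j => Q j x)).
Proof.
move=> exQ mQ t.
rewrite (_ : [set x | _] =
    [set x | Q t x /\ forall i, i < t -> ~ Q i x]); last first.
  apply/seteqP; split => x /=; last by case; exact: first_index_eq.
  by move=> <-; apply: first_indexP.
apply: measurable_and => //; apply: measurable_forall => i.
by apply: measurable_imply; [exact: measurable_const|exact: measurable_not].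
Qed.

End FirstTime.

Section Iterates.
Local Open Scope nat_scope.
Context (Z : Type) (U V : Z -> Z) (UK : cancel U V).

Lemma iterK j : cancel (iter j U) (iter j V).
Proof. by elim: j => // j IH x; rewrite iterSr iterS UK IH. Qed.

Lemma iter_subK i j x : i <= j -> iter i V (iter j U x) = iter (j - i) U x.
Proof. by move=> ij; rewrite -{1}(subnKC ij) iterD iterK. Qed.

End Iterates.

(** * Blocks between visits to a set *)

Section Blocks.
Local Open Scope nat_scope.
Context (Z : Type) (U V : Z -> Z).

Definition age (B : set Z) (x : Z) := first_index (fun j => B (iter j V x)).
Definition base (B : set Z) (x : Z) := iter (age B x) V x.
(* One less than the return time, so that the block of [y] in [B] consists of
   the [last_age B y + 1] points [iter j U y] with [j <= last_age B y]. *)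
Definition last_age (B : set Z) (x : Z) := first_index (fun j => B (iter j.+1 U x)).
(** This also holds when [U x] returns to [B] exactly at the base of the block of [x]; the block is
    then a whole periodic orbit. *)
Definition stay (B : set Z) (x : Z) := base B (U x) = base B x.

Context (UK : cancel U V) (VK : cancel V U) (B : set Z).
Context (bwd : forall x, exists j, B (iter j V x)).
Context (fwd : forall x, exists j, B (iter j.+1 U x)).

Lemma base_in x : B (base B x).
Proof. by have [] := first_indexP (bwd x). Qed.

Lemma age_in x : B x -> age B x = 0.
Proof. by move=> Bx; apply: first_index_eq. Qed.

Lemma base_id x : B x -> base B x = x.
Proof. by move=> Bx; rewrite /base age_in. Qed.

Lemma age_out x : ~ B x -> age B x = (age B (V x)).+1.
Proof.
move=> nBx; have [Bv vmin] := first_indexP (bwd (V x)).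
apply: first_index_eq => [|[//|i]]; first by rewrite iterSr.
by rewrite ltnS iterSr => /vmin.
Qed.

Lemma base_out x : ~ B x -> base B x = base B (V x).
Proof. by move=> nBx; rewrite /base age_out// iterSr. Qed.

Lemma iter_base x : iter (age B x) U (base B x) = x.
Proof. exact: iterK. Qed.

Lemma base_block y j : B y -> j <= last_age B y ->
  base B (iter j U y) = y /\ age B (iter j U y) = j.
Proof.
move=> By; elim: j => [_|j IH jr]; first by rewrite base_id// age_in.
have [_ /(_ _ jr) nB] := first_indexP (fwd y).
by rewrite base_out// age_out//= UK; have [-> ->] := IH (ltnW jr).
Qed.

(** A return to [B] after the base and no later than [x] would be a more recent visit than the base
    itself. *)
Lemma age_le_last x : age B x <= last_age B (base B x).
Proof.
rewrite leqNgt; apply/negP => lt.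
have [+ _] := first_indexP (fwd (base B x)).
rewrite -/(last_age _ _) /base (iter_subK VK) -/(base B x)//.
by have [_] := first_indexP (bwd x); apply; rewrite ltn_subrL /= (leq_trans _ lt).
Qed.

Lemma next_in x : B (U x) <-> age B x = last_age B (base B x).
Proof.
split => [Bx|e]; last first.
  have [+ _] := first_indexP (fwd (base B x)).
  by rewrite -/(last_age _ _) -e iterS iter_base.
apply/eqP; rewrite eqn_leq age_le_last leqNgt; apply/negP.
have [_ /[apply]] := first_indexP (fwd (base B x)).
by apply; rewrite iterS iter_base.
Qed.

(** The backward walk from [x] to [B'] cannot stop before it meets [B], so it passes through
    [base B x]. Blocks of [B'] are thus unions of blocks of [B]. *)
Lemma base_sub (B' : set Z) x : B' `<=` B -> (forall x, exists j, B' (iter j V x)) ->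
  base B' (base B x) = base B' x.
Proof.
move=> sB bwd'; have [n] := ubnP (age B x); elim: n x => // n IH x lt.
have [Bx|nBx] := pselect (B x); first by rewrite (base_id Bx).
have e : age B' x = (age B' (V x)).+1.
  have [Bv vmin] := first_indexP (bwd' (V x)).
  apply: first_index_eq => [|[_ /sB//|i]]; first by rewrite iterSr.
  by rewrite ltnS iterSr => /vmin.
rewrite base_out// IH; last by rewrite -ltnS -age_out.
by rewrite /base e iterSr.
Qed.

Context (alpha : Z -> nat).

(** The length of the word records the length of the block. Pickling into [nat] lets a name enter
    the letters of the next stage. *)
Definition block_name (x : Z) : nat :=
  pickle (age B x,
    [seq alpha (iter j U (base B x)) | j <- iota 0 (last_age B (base B x)).+1]).

Lemma block_nameP x y : block_name x = block_name y <->
  [/\ age B x = age B y, last_age B (base B x) = last_age B (base B y) &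
     forall j, j <= last_age B (base B x) ->
       alpha (iter j U (base B x)) = alpha (iter j U (base B y))].
Proof.
rewrite /block_name; split => [/(pcan_inj pickleK) e|[-> es ea]].
  have ea : age B x = age B y := congr1 (fun p => p.1) e.
  have es := congr1 (fun p => p.2) e; rewrite /fst /snd in es.
  have /eqP := congr1 size es; rewrite !size_map !size_iota eqSS => /eqP es'.
  split => // j jr; have /(congr1 (nth 0 ^~ j)) := es.
  by rewrite !(nth_map 0) ?size_iota// -?es'// !nth_iota -?es'.
congr (pickle (_, _)); rewrite -es; apply/eq_in_map => j.
by rewrite mem_iota add0n ltnS => /andP[_ /ea].
Qed.

Lemma block_name_alpha x y : block_name x = block_name y -> alpha x = alpha y.
Proof.
move=> /block_nameP [ea es h]; rewrite -(iter_base x) -(iter_base y) -ea.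
exact/h/age_le_last.
Qed.

Context (alpha_stay : forall x y, alpha x = alpha y -> stay B x -> stay B y).

(** [x] and [U x] share their base, hence the word along the block; only the age moves. *)
Lemma block_name_fwd x y : stay B x ->
  block_name x = block_name y -> block_name (U x) = block_name (U y).
Proof.
move=> sx nxy; have sy := alpha_stay (block_name_alpha nxy) sx.
move: nxy => /block_nameP [ea es h]; apply/block_nameP; rewrite sx sy; split => //.
(* If [U x] is in [B], the block closes up into a periodic orbit and the age drops to 0; [next_in]
   reads this off the age and the length, which [x] and [y] share. *)
have [Bx|nBx] := pselect (B (U x)).
  rewrite age_in// age_in//; apply/next_in; rewrite -ea -es; exact/next_in.
rewrite (age_out nBx) UK (@age_out (U y)) ?UK ?ea//.
by move/next_in => e; apply: nBx; apply/next_in; rewrite ea es.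
Qed.

(** Off [B], both predecessors lie in the same blocks as the points. If [x] is in [B], staying at
    [V x] makes the block a cycle, and the block of [y] must be shown to close up too. *)
Lemma block_name_bwd x y : stay B (V x) -> block_name x = block_name y ->
  stay B (V y) /\ block_name (V x) = block_name (V y).
Proof.
move=> sx nxy; move: (nxy) => /block_nameP [ea es h].
have [Bx|nBx] := pselect (B x); last first.
  have nBy : ~ B y by move=> By; move: ea; rewrite (age_out nBx) (age_in By).
  split; first by rewrite /stay VK base_out.
  apply/block_nameP; rewrite -(base_out nBx) -(base_out nBy); split => //.
  by move: ea; rewrite (age_out nBx) (age_out nBy) => -[].
have By : B y.
  by apply: contrapT => nBy; move: ea; rewrite (age_in Bx) (age_out nBy).
move: sx; rewrite /stay VK (base_id Bx) => sx.
rewrite (base_id Bx) (base_id By) in es h.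
have ar : age B (V x) = last_age B x.
  by rewrite {2}sx; apply/next_in; rewrite VK.
have ix : iter (last_age B x) U x = V x by rewrite -ar {2}sx iter_base.
have sxr : stay B (iter (last_age B x) U x) by rewrite ix /stay VK (base_id Bx).
(* [V x] is the last point of its block, so equality of the last letters transfers [stay] to the
   last point of the block of [y], which is therefore [V y]. *)
have := alpha_stay (h _ (leqnn _)) sxr; rewrite es => syr.
have [Byr _] := first_indexP (fwd y); rewrite -/(last_age B y) iterS in Byr.
move: syr; rewrite /stay base_id//.
have [-> _] := base_block By (leqnn (last_age B y)) => yr.
have Vy : V y = iter (last_age B y) U y by rewrite -{1}yr UK.
have [bVy aVy] := base_block By (leqnn (last_age B y)).
split; first by rewrite /stay VK (base_id By) Vy.
apply/block_nameP; rewrite -sx ar Vy bVy aVy; split => //.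
Qed.

End Blocks.

(** * Markers, labels and codes *)

Section Recurrence.
Local Open Scope nat_scope.
Context (Z : Type).
Implicit Types (W : Z -> Z) (C : set Z).

Definition infinitely_often W C (x : Z) :=
  forall n, exists j, n <= j /\ C (iter j W x).

Lemma infinitely_often_shift W C x :
  infinitely_often W C (W x) <-> infinitely_often W C x.
Proof.
split => io n.
  by have [j [nj Cj]] := io n; exists j.+1; rewrite iterSr; split => //; exact: leqW.
have [[|j] [nj Cj]] := io n.+1; first by [].
by exists j; rewrite -iterSr.
Qed.

Context (U V : Z -> Z).

Definition recurrent C (x : Z) := infinitely_often U C x /\ infinitely_often V C x.

Context (UK : cancel U V) (VK : cancel V U).

Lemma recurrent_iterU C j x : recurrent C (iter j U x) <-> recurrent C x.
Proof.
elim: j => //= j <-; rewrite /recurrent infinitely_often_shift.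
by rewrite -(infinitely_often_shift V) UK.
Qed.

Lemma recurrent_iterV C j x : recurrent C (iter j V x) <-> recurrent C x.
Proof. by rewrite -(recurrent_iterU _ j) (iterK VK). Qed.

Context (A : nat -> set Z).

(* Passing to [marker n `&` A n] on the orbits where this set recurs forces
   the intersection of all the markers to meet almost every orbit at most
   once; elsewhere [marker n] is kept so that every orbit stays marked. *)
Fixpoint marker (n : nat) : set Z :=
  if n is m.+1 then
    [set x | marker m x /\ (recurrent (marker m `&` A m) x -> A m x)]
  else setT.

Lemma marker_sub n m : n <= m -> marker m `<=` marker n.
Proof.
move=> /subnK <-; elim: (m - n) => // k IH x [? _]; exact: IH.
Qed.

(** The new marker agrees with the intersection of [marker n] and [A n] on the orbits where that set
    recurs, and with [marker n] on the others; recurrence is an orbit invariant. *)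
Lemma marker_recurrent n x : recurrent (marker n) x.
Proof.
elim: n x => [x|n IH x]; first by split => k; exists k.
have [r|nr] := pselect (recurrent (marker n `&` A n) x).
  have [iU iV] := r; split => k.
    by have [j [kj [? ?]]] := iU k; exists j.
  by have [j [kj [? ?]]] := iV k; exists j.
have [iU iV] := IH x; split => k.
  have [j [kj ?]] := iU k; exists j; split => //; split => //.
  by move/recurrent_iterU.
have [j [kj ?]] := iV k; exists j; split => //; split => //.
by move/recurrent_iterV.
Qed.

Lemma marker_bwd n x : exists j, marker n (iter j V x).
Proof. by have [_ /(_ 0)[j [_ ?]]] := marker_recurrent n x; exists j. Qed.

Lemma marker_fwd n x : exists j, marker n (iter j.+1 U x).
Proof. by have [/(_ 1)[[|j] [lt Mj]] _] := marker_recurrent n x; [|exists j]. Qed.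

Local Notation base_ n := (base V (marker n)).
Local Notation stay_ n := (stay U V (marker n)).
Local Notation age_ n := (age V (marker n)).

(* The [stay] bit makes a label determine whether its block is a whole periodic
   orbit, in which case [U] maps the last point of the block to its base. *)
Definition split_label (p : Z -> nat) n (x : Z) : nat :=
  pickle (p x, (`[< A n x >], `[< stay_ n x >])).

Fixpoint label (n : nat) : Z -> nat :=
  if n is m.+1 then block_name U V (marker n) (split_label (label m) n)
  else block_name U V (marker 0) (split_label (fun=> 0) 0).

(* The digit [n.+1] depends only on the base of the block, so [U] preserves it
   inside blocks; a digit of [label] would change with the age. *)
Definition code (n : nat) (x : Z) : nat :=
  if n is m.+1 then label n (base_ m x) else label 0 x.

Lemma split_labelP p n x y : split_label p n x = split_label p n y ->
  [/\ p x = p y, A n x <-> A n y & stay_ n x <-> stay_ n y].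
Proof.
move=> /(pcan_inj pickleK) [-> eA eS].
by split => //; [move: eA|move: eS]; do 2 case: asboolP => // ?.
Qed.

Lemma label_split n x y : label n x = label n y ->
  [/\ n != 0 -> label n.-1 x = label n.-1 y, A n x <-> A n y &
      stay_ n x <-> stay_ n y].
Proof.
case: n => [|n] /(block_name_alpha VK (marker_bwd _) (marker_fwd _)) /split_labelP.
  by case.
by case.
Qed.

Lemma label_stay n x y : label n x = label n y -> stay_ n x -> stay_ n y.
Proof. by move=> /label_split[_ _ ->]. Qed.

Lemma label_age n x y : label n x = label n y -> age_ n x = age_ n y.
Proof. by case: n => [|n] /block_nameP[]. Qed.

Lemma split_label_stay p n x y :
  split_label p n x = split_label p n y -> stay_ n x -> stay_ n y.
Proof. by move=> /split_labelP[_ _ ->]. Qed.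

Lemma label_fwd n x y : stay_ n x -> label n x = label n y ->
  label n (U x) = label n (U y).
Proof.
by case: n => [|n]; exact: (block_name_fwd UK VK (marker_bwd _) (marker_fwd _)
  (@split_label_stay _ _)).
Qed.

Lemma label_bwd n x y : stay_ n (V x) -> label n x = label n y ->
  stay_ n (V y) /\ label n (V x) = label n (V y).
Proof.
by case: n => [|n]; exact: (block_name_bwd UK VK (marker_bwd _) (marker_fwd _)
  (@split_label_stay _ _)).
Qed.

(** By [base_sub], the base at stage [m] is a function of the base at stage [n]. *)
Lemma stay_mono n m x : n <= m -> stay_ n x -> stay_ m x.
Proof.
move=> nm sx; rewrite /stay.
have bb y : base_ m (base_ n y) = base_ m y.
  exact: (base_sub (marker_bwd _) _ (marker_sub nm) (marker_bwd _)).
by rewrite -bb sx bb.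
Qed.

Lemma stay_before n j x : j < age_ n x -> stay_ n (iter j.+1 V x).
Proof.
move=> lt; rewrite /stay iterS VK base_out; [by []|exact: marker_bwd|].
by have [_] := first_indexP (marker_bwd n x); apply.
Qed.

(** Digits up to [n] fix the age at stage [n], and the next digit is the label of the base. Since
    [U] inside a stage-[n] block also stays at stage [n.+1], [label_fwd] carries equal labels from
    the bases to the points and [label_bwd] carries them back. *)
Lemma code_label n x y :
  (forall i, i <= n -> code i x = code i y) <-> label n x = label n y.
Proof.
elim: n x y => [|n IH] x y.
  split; first by move/(_ 0 (leqnn _)).
  by move=> ? i; rewrite leqn0 => /eqP ->.
split => [h|h].
  have /IH/label_age ea : forall i, i <= n -> code i x = code i y.
    by move=> i ?; apply: h; exact: leqW.
  have eb : label n.+1 (base_ n x) = label n.+1 (base_ n y).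
    exact: h (leqnn _).
  suff step j : j <= age_ n x ->
      label n.+1 (iter j U (base_ n x)) = label n.+1 (iter j U (base_ n y)).
    rewrite -(iter_base VK (marker n) x) -(iter_base VK (marker n) y) -ea.
    exact: step.
  elim: j => // j IHj lt; rewrite !iterS; apply: label_fwd; last exact/IHj/ltnW.
  rewrite /base (iter_subK VK) ?(ltnW lt)//.
  apply: (stay_mono (leqnSn n)); rewrite -[_ - _]prednK ?subn_gt0//.
  by apply: stay_before; rewrite prednK ?subn_gt0// leq_subr.
have [/(_ isT) ln _ _] := label_split h.
move=> i; rewrite leq_eqVlt => /orP[/eqP ->|]; last exact: (IH x y).2 ln i.
suff step j : j <= age_ n x ->
    label n.+1 (iter j V x) = label n.+1 (iter j V y).
  by rewrite /= /base -(label_age ln); exact: step.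
elim: j => // j IHj lt; rewrite !iterS; apply: (label_bwd _ _).2; last exact/IHj/ltnW.
exact/(stay_mono (leqnSn n))/stay_before.
Qed.

(** Digit [k] is read at the base of stage [k.-1], which [x] and [U x] share once [n <= k.-1]. *)
Lemma code_stay n k x : stay_ n x -> n < k -> code k (U x) = code k x.
Proof.
case: k => // k sx; rewrite ltnS => nk; congr (label _ _).
exact: (stay_mono nk sx).
Qed.

Hypothesis A_sep : forall x y, (forall n, A n x <-> A n y) -> x = y.

Lemma label_sep x y : (forall n, label n x = label n y) -> x = y.
Proof. by move=> h; apply: A_sep => n; have [] := label_split (h n). Qed.

End Recurrence.

(** * Recurrence and null sets *)

Section MeasurePreservingNullSets.
Context d (Z : measurableType d) (R : realType) (nu : probability Z R).

Lemma measurable_fun_iter (W : Z -> Z) j :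
  measurable_fun setT W -> measurable_fun setT (iter j W).
Proof.
move=> mW; elim: j => [|j IH]; first exact: measurable_id.
exact: measurableT_comp mW IH.
Qed.

Lemma measurable_iter (W : Z -> Z) (C : set Z) j :
  measurable_fun setT W -> measurable C -> measurable [set x | C (iter j W x)].
Proof.
by move=> mW mC; have := measurable_fun_iter j mW measurableT mC; rewrite setTI.
Qed.

Lemma null_subset (A B : set Z) :
  measurable A -> measurable B -> A `<=` B -> nu B = 0%E -> nu A = 0%E.
Proof. by move=> mA mB AB nB; apply: (subset_measure0 mA mB AB). Qed.

Lemma null_exists (I : countType) (P : I -> Z -> Prop) :
  (forall i, measurable [set x | P i x]) -> (forall i, nu [set x | P i x] = 0%E) ->
  nu [set x | exists i, P i x] = 0%E.
Proof.
move=> mP nP.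
pose F n := if unpickle n is Some i then [set x | P i x] else set0.
have mF n : measurable (F n) by rewrite /F; case: unpickle.
apply: measure_negligible; first exact: measurable_exists.
apply: (@negligibleS _ _ _ _ (\bigcup_n F n)).
  by move=> x [i Pix]; exists (pickle i) => //; rewrite /F pickleK.
apply: negligible_bigcup => n; apply/negligibleP => //.
by rewrite /F; case: unpickle.
Qed.

Context (W : Z -> Z) (mW : measurable_fun setT W).
Context (nuW : forall A : set Z, measurable A -> nu (W @^-1` A) = nu A).

Lemma measure_iter (C : set Z) j :
  measurable C -> nu [set x | C (iter j W x)] = nu C.
Proof.
move=> mC; elim: j => //= j IH; rewrite -{}IH.
rewrite -[RHS]nuW; last exact: measurable_iter.
by congr (nu _); apply/seteqP; split => x /=; rewrite -iterS iterSr.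
Qed.

(** The preimages of [C] under the iterates are disjoint and of equal mass, so every multiple of
    this mass is at most 1. *)
Lemma wandering_null (C : set Z) : measurable C ->
  (forall x j, C x -> ~ C (iter j.+1 W x)) -> nu C = 0%E.
Proof.
move=> mC wC; pose F j := [set x | C (iter j W x)].
have mF j : measurable (F j) by exact: measurable_iter.
have tF : trivIset setT F.
  apply/trivIsetP => i j _ _; wlog lt : i j / (i < j)%N.
    by move=> h; rewrite neq_lt => /orP[]ij; [|rewrite setIC];
      apply: h => //; rewrite ?lt_eqF ?(gtn_eqF ij)// neq_ltn ij.
  move=> _; rewrite -subset0 => x [/= Ci Cj]; apply: (wC _ (j - i.+1)%N Ci).
  by rewrite -iterD subnSK// subnK// ltnW.
have le1 n : (n%:R * fine (nu C) <= 1)%R.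
  have := measure_bigsetU nu mF tF n.
  rewrite (eq_bigr (fun=> (fine (nu C))%:E)); last first.
    by move=> i _; rewrite fineK ?fin_num_measure//; exact: measure_iter.
  rewrite sumEFin sumr_const card_ord => e.
  rewrite mulr_natl -lee_fin -e; apply: probability_le1.
  exact: bigsetU_measurable.
have fn : nu C \is a fin_num by rewrite fin_num_measure.
rewrite -(fineK fn); congr (_%:E); apply/eqP; rewrite eq_le fine_ge0// andbT.
rewrite leNgt; apply/negP => pos.
have := le1 (Num.truncn (fine (nu C))^-1).+1.
rewrite leNgt => /negP; apply; rewrite -ltr_pdivrMr// mul1r.
exact: truncnS_gt.
Qed.

(** Poincare recurrence: a point of [C] with finitely many visits has a last one, and the set [L] of
    last visits is wandering. *)
Lemma recurrence_null (C : set Z) : measurable C ->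
  nu [set x | C x /\ ~ infinitely_often W C x] = 0%E.
Proof.
move=> mC.
pose L := [set x | C x /\ forall j, ~ C (iter j.+1 W x)].
have mL : measurable L.
  apply: measurable_and => //; apply: measurable_forall => j.
  by apply: measurable_not; exact: measurable_iter.
have L0 : nu L = 0%E by apply: wandering_null => // x j [_ h] [] /h.
apply: (@null_subset _ [set x | exists i, L (iter i W x)]).
- apply: measurable_and => //; apply: measurable_not; apply: measurable_forall => n.
  apply: measurable_exists => j; apply: measurable_and; first exact: measurable_const.
  exact: measurable_iter.
- by apply: measurable_exists => i; exact: measurable_iter.
- move=> x [Cx /existsNP[n nio]].
  have exC : exists j, `[< C (iter j W x) >] by exists 0%N; apply/asboolP.
  have bound j : `[< C (iter j W x) >] -> (j <= n)%N.
    move=> /asboolP Cj; rewrite leqNgt; apply/negP => nj; apply: nio.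
    by exists j; split => //; exact: ltnW.
  case: (ex_maxnP exC bound) => m /asboolP Cm mmax; exists m; split => // j.
  rewrite -iterD => /asboolP /mmax; apply/negP.
  by rewrite -ltnNge addSn ltnS leq_addl.
- by apply: null_exists => i; [exact: measurable_iter|rewrite measure_iter].
Qed.

End MeasurePreservingNullSets.

(** * Measurability of markers and labels; almost every point eventually stays in its block *)

Section MarkerMeasurability.
Context d (Z : measurableType d) (U V : Z -> Z).
Context (UK : cancel U V) (VK : cancel V U).
Context (mU : measurable_fun setT U) (mV : measurable_fun setT V).
Context (A : nat -> set Z) (mA : forall n, measurable (A n)).
Context (A_sep : forall x y, (forall n, A n x <-> A n y) -> x = y).

Local Notation M n := (marker U V A n).
Local Notation stay_ n := (stay U V (M n)).

Lemma measurable_infinitely_often (W : Z -> Z) (C : set Z) :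
  measurable_fun setT W -> measurable C ->
  measurable [set x | infinitely_often W C x].
Proof.
move=> mW mC; apply: measurable_forall => n; apply: measurable_exists => j.
by apply: measurable_and; [exact: measurable_const|exact: measurable_iter].
Qed.

Lemma measurable_recurrent (C : set Z) :
  measurable C -> measurable [set x | recurrent U V C x].
Proof.
by move=> mC; apply: measurable_and; exact: measurable_infinitely_often.
Qed.

Lemma measurable_marker n : measurable (M n).
Proof.
elim: n => [|n IH]; first exact: measurableT.
apply: measurable_and => //; apply: measurable_imply; last exact: mA.
by apply: measurable_recurrent; exact: measurableI.
Qed.

Lemma measurable_fibers_age n : measurable_fibers (age V (M n)).
Proof.
apply: measurable_fibers_first_index; first exact: marker_bwd.
by move=> j; apply: measurable_iter => //; exact: measurable_marker.
Qed.

Lemma measurable_fibers_last_age n : measurable_fibers (last_age U (M n)).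
Proof.
apply: measurable_fibers_first_index; first exact: marker_fwd.
by move=> j; apply: measurable_iter => //; exact: measurable_marker.
Qed.

Lemma measurable_base n : measurable_fun setT (base V (M n)).
Proof.
apply: (measurable_fun_select (F := fun j x => iter j V x)).
  exact: measurable_fibers_age.
by move=> j; exact: measurable_fun_iter.
Qed.

(** The separating family turns equality of points into countably many measurable conditions. *)
Lemma measurable_fun_eq (f g : Z -> Z) : measurable_fun setT f ->
  measurable_fun setT g -> measurable [set x | f x = g x].
Proof.
move=> mf mg; rewrite (_ : [set x | _] =
    [set x | forall n, A n (f x) <-> A n (g x)]).
  apply: measurable_forall => n; apply: measurable_iff.
    by have := mf measurableT _ (mA n); rewrite setTI.
  by have := mg measurableT _ (mA n); rewrite setTI.
by apply/seteqP; split => x /=; [move=> ->|move=> /A_sep].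
Qed.

Lemma measurable_stay n : measurable [set x | stay_ n x].
Proof.
apply: measurable_fun_eq; last exact: measurable_base.
by apply: measurableT_comp => //; exact: measurable_base.
Qed.

Lemma measurable_fibers_name (a : Z -> nat) n :
  measurable_fibers a -> measurable_fibers (block_name U V (M n) a).
Proof.
move=> ma; apply: measurable_fibers_comp; apply: measurable_fibers_pair.
  exact: measurable_fibers_age.
apply: (measurable_fibers_select (k := fun x => last_age U (M n) (base V (M n) x))
  (F := fun m x => [seq a (iter j U (base V (M n) x)) | j <- iota 0 m.+1])).
  apply: measurable_fibers_precomp; first exact: measurable_base.
  exact: measurable_fibers_last_age.
move=> m; apply: measurable_fibers_map => j.
apply: (@measurable_fibers_precomp _ _ _ a) => //.
by apply: measurableT_comp; [exact: measurable_fun_iter|exact: measurable_base].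
Qed.

Lemma measurable_fibers_split_label (p : Z -> nat) n :
  measurable_fibers p -> measurable_fibers (split_label U V A p n).
Proof.
move=> mp; apply: measurable_fibers_comp; apply: measurable_fibers_pair => //.
by apply: measurable_fibers_pair; apply: measurable_fibers_asbool;
  [exact: mA|exact: measurable_stay].
Qed.

Lemma measurable_fibers_label n : measurable_fibers (label U V A n).
Proof.
elim: n => [|n IH]; apply: measurable_fibers_name;
  apply: measurable_fibers_split_label => //.
exact: measurable_fibers_cst.
Qed.

Lemma measurable_fibers_code n : measurable_fibers (code U V A n).
Proof.
case: n => [|n]; first exact: (measurable_fibers_label 0).
apply: (@measurable_fibers_precomp _ _ _ (label U V A n.+1)).
  exact: measurable_base.
exact: measurable_fibers_label.
Qed.

Context (R : realType) (nu : probability Z R).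
Context (nuU : forall C : set Z, measurable C -> nu (U @^-1` C) = nu C).

Lemma measure_preserving_inverse C : measurable C -> nu (V @^-1` C) = nu C.
Proof.
move=> mC; have mVC : measurable (V @^-1` C).
  by rewrite -[_ @^-1` _]setTI; exact: mV.
rewrite -(nuU mVC); congr (nu _).
by apply/seteqP; split => x /=; rewrite UK.
Qed.

(** If [y] is in [A n], the intersection of [M n] and [A n] recurs for [y], hence for [z], and then
    [z] in [M n.+1] forces [z] in [A n]. By symmetry no [A n] separates the two points. *)
Lemma markers_meet_orbit_once y z :
  (forall n, M n y -> A n y -> recurrent U V (M n `&` A n) y) ->
  (forall n, M n z -> A n z -> recurrent U V (M n `&` A n) z) ->
  (forall C, recurrent U V C y <-> recurrent U V C z) ->
  (forall n, M n y) -> (forall n, M n z) -> y = z.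
Proof.
move=> ry rz yz My Mz; apply: A_sep => n; split => An.
  by have [_] := Mz n.+1; apply; apply/yz; exact: ry.
by have [_] := My n.+1; apply; apply/yz; exact: rz.
Qed.

(** The two points in all markers coincide, so the orbit is periodic. At a late stage only [U x]
    remains marked on it, which makes it the base of [x]. *)
Lemma stay_eventually x :
  (forall n j y, y = iter j U x \/ y = iter j V x ->
     M n y -> A n y -> recurrent U V (M n `&` A n) y) ->
  forall j, (forall n, M n (U x)) -> (forall n, M n (iter j.+2 U x)) ->
  exists n, stay_ n x.
Proof.
move=> good j My My'.
have once w z : (forall C, recurrent U V C w <-> recurrent U V C x) ->
    (forall C, recurrent U V C z <-> recurrent U V C x) ->
    (exists i, w = iter i U x \/ w = iter i V x) ->
    (exists i, z = iter i U x \/ z = iter i V x) ->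
    (forall n, M n w) -> (forall n, M n z) -> w = z.
  move=> wx zx [i iw] [k kz] Mw Mz; apply: markers_meet_orbit_once => //.
  - by move=> n; exact: good iw.
  - by move=> n; exact: good kz.
  - by move=> C; rewrite wx zx.
have per : U x = iter j.+2 U x.
  apply: once => //; try by [exists 1; left|exists j.+2; left].
  - by move=> C; exact: (recurrent_iterU UK C 1).
  - by move=> C; exact: recurrent_iterU.
have Vx : iter j V x = U x.
  by rewrite -[in LHS](UK x) -iterSr [in LHS]per (iter_subK UK)// subSnn.
(* [f i] is the first stage whose marker excludes the [i]-th predecessor of [x], or 0 if none does.
   Predecessors up to [j] that are still marked at stage [n] lie in all markers. *)
pose f i := first_index (fun n => ~ M n (iter i V x)).
pose n := (\max_(i < j.+1) f i)%N.
have aj : (age V (M n) x <= j)%N.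
  rewrite leqNgt; apply/negP => ja.
  by have [_ /(_ _ ja)] := first_indexP (marker_bwd UK VK A n x); rewrite Vx; apply.
exists n; rewrite /stay base_id//.
apply: once => //; try by [exists 1; left|exists (age V (M n) x); right].
- by move=> C; exact: (recurrent_iterU UK C 1).
- by move=> C; exact: recurrent_iterV.
- apply: contrapT => /existsNP ex.
  have [+ _] := first_indexP ex; apply.
  have fn : (f (age V (M n) x) <= n)%N.
    exact: (@leq_bigmax _ (fun i : 'I_j.+1 => f i) (Ordinal (aj : age V (M n) x < j.+1)%N)).
  apply: (marker_sub fn); exact: (base_in (marker_bwd UK VK A n)).
Qed.

(** If [U] never stays at [x], then [U x] is in every marker. Off a null set of orbits, a second
    visit to the set of such points would contradict [stay_eventually], so the set is wandering
    there. *)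
Lemma never_stay_null : nu [set x | forall n, ~ stay_ n x] = 0%E.
Proof.
pose N := [set x | exists n, (M n `&` A n) x /\ ~ recurrent U V (M n `&` A n) x].
have mMA n : measurable (M n `&` A n).
  by apply: measurableI => //; exact: measurable_marker.
have mN : measurable N.
  apply: measurable_exists => n; apply: measurable_and; first exact: mMA.
  by apply: measurable_not; exact: measurable_recurrent.
have nuV := measure_preserving_inverse.
have N0 : nu N = 0%E.
  apply: null_exists => n.
    apply: measurable_and; first exact: mMA.
    by apply: measurable_not; exact: measurable_recurrent.
  apply/negligibleP.
    apply: measurable_and; first exact: mMA.
    by apply: measurable_not; exact: measurable_recurrent.
  have nio W : measurable_fun setT W ->
      (forall C : set Z, measurable C -> nu (W @^-1` C) = nu C) ->
      nu.-negligible
        [set x | (M n `&` A n) x /\ ~ infinitely_often W (M n `&` A n) x].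
    move=> mW nuW; apply/negligibleP; last exact: recurrence_null.
    apply: measurable_and; first exact: mMA.
    by apply: measurable_not; exact: measurable_infinitely_often.
  apply: (negligibleS _ (negligibleU (nio U mU nuU) (nio V mV nuV))).
  move=> x [MAx /not_andP[]]; [by left|by right].
(* [stay_eventually] needs recurrence along the full orbit, so [N] is saturated in both
   directions. *)
pose S := [set x | (exists j, N (iter j U x)) \/ (exists j, N (iter j V x))].
have mSU : measurable [set x | exists j, N (iter j U x)].
  by apply: measurable_exists => j; exact: measurable_iter.
have mSV : measurable [set x | exists j, N (iter j V x)].
  by apply: measurable_exists => j; exact: measurable_iter.
have mS : measurable S by exact: measurableU.
have S0 : nu S = 0%E.
  apply: measure_negligible => //; apply: negligibleU; apply/negligibleP => //.
    by apply: null_exists => j; [exact: measurable_iter|rewrite measure_iter].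
  by apply: null_exists => j; [exact: measurable_iter|rewrite measure_iter].
pose H := [set x | forall n, ~ stay_ n x].
have mH : measurable H.
  by apply: measurable_forall => n; apply: measurable_not; exact: measurable_stay.
have HS0 : nu (H `\` S) = 0%E.
  apply: (@wandering_null _ _ _ nu U) => //; first exact: measurableD.
  move=> x j [Hx Sx] [Hy _].
  have inM w : H w -> forall n, M n (U w).
    move=> Hw n; apply: contrapT => nM; apply: (Hw n).
    by rewrite /stay base_out ?UK//; exact: marker_bwd.
  have [|||n] := @stay_eventually x _ j; last exact: Hx.
  - move=> n i y xy My Ay; apply: contrapT => nr; apply: Sx.
    by case: xy => xy; [left|right]; exists i; exists n; rewrite -xy.
  - exact: inM.
  - exact: (inM _ Hy).
apply: measure_negligible => //; apply: (@negligibleS _ _ _ _ ((H `\` S) `|` S)).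
  by move=> x Hx; case: (pselect (S x)); [right|left].
by apply: negligibleU; apply/negligibleP => //; exact: measurableD.
Qed.

End MarkerMeasurability.

(** * The uniform law *)

Section RealProbability.
Context d (Z : measurableType d) (R : realType) (nu : probability Z R).

Definition rprob (C : set Z) : R := fine (nu C).

Lemma rprobE C : measurable C -> nu C = (rprob C)%:E.
Proof. by move=> mC; rewrite fineK// fin_num_measure. Qed.

Lemma rprob_ge0 C : 0 <= rprob C.
Proof. by rewrite fine_ge0. Qed.

Lemma le_rprob C D : measurable C -> measurable D -> C `<=` D ->
  rprob C <= rprob D.
Proof.
move=> mC mD CD; rewrite -lee_fin -!rprobE//.
by apply: le_measure; rewrite ?inE.
Qed.

Lemma rprob_le1 C : measurable C -> rprob C <= 1.
Proof. by move=> mC; rewrite -lee_fin -rprobE// probability_le1. Qed.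

Lemma rprobU C D : measurable C -> measurable D -> C `&` D = set0 ->
  rprob (C `|` D) = rprob C + rprob D.
Proof.
move=> mC mD CD; apply: EFin_inj; rewrite EFinD -!rprobE ?measureU//.
exact: measurableU.
Qed.

Lemma rprob_setC C : measurable C -> rprob (~` C) = 1 - rprob C.
Proof.
move=> mC; apply: EFin_inj; rewrite EFinB -!rprobE ?probability_setC//.
exact: measurableC.
Qed.

(** A finite union from a chain is empty or inside one member; continuity from below passes the
    bound to the full union. The sign of [t] covers the empty case. *)
Lemma rprob_chain_le (I : countType) (D : I -> set Z) (t : R) :
  (forall i, measurable (D i)) -> (forall i j, D i `<=` D j \/ D j `<=` D i) ->
  0 <= t -> (forall i, rprob (D i) <= t) -> rprob [set x | exists i, D i x] <= t.
Proof.
move=> mD chain t0 Dt.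
pose F n := [set x | exists i, (pickle i < n)%N /\ D i x].
have mF n : measurable (F n).
  apply: measurable_exists => i; apply: measurable_and; last exact: mD.
  exact: measurable_const.
have Ft n : F n = set0 \/ exists i, F n `<=` D i.
  elim: n => [|n [F0|[i Fi]]].
  - by left; rewrite -subset0 => x [i []].
  - have [[i pi]|np] := pselect (exists i : I, pickle i = n); last first.
      left; rewrite -subset0 => x [i [+ Di]].
      rewrite ltnS leq_eqVlt => /orP[/eqP pi|lt]; first by apply: np; exists i.
      by rewrite -F0; exists i.
    right; exists i => x [j [+ Dj]].
    rewrite ltnS leq_eqVlt -pi => /orP[/eqP/(pcan_inj pickleK) <-//|lt].
    by have : F n x by [exists j; rewrite -pi]; rewrite F0.
  - right; have [[j pj]|np] := pselect (exists j : I, pickle j = n); last first.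
      exists i => x [j [+ Dj]].
      rewrite ltnS leq_eqVlt => /orP[/eqP pj|lt]; first by case: np; exists j.
      by apply: Fi; exists j.
    have [ij|ji] := chain i j; [exists j|exists i] => x [k [+ Dk]];
      rewrite ltnS leq_eqVlt -pj => /orP[/eqP/(pcan_inj pickleK) e|lt].
    - by rewrite -e.
    - by apply/ij/Fi; exists k; rewrite -pj.
    - by apply: ji; rewrite -e.
    - by apply: Fi; exists k; rewrite -pj.
have UF : \bigcup_n F n = [set x | exists i, D i x].
  apply/seteqP; split => x /=; first by case=> n _ [i [_ Di]]; exists i.
  by case=> i Di; exists (pickle i).+1 => //; exists i.
have mUF : measurable (\bigcup_n F n) by exact: bigcupT_measurable.
rewrite -UF -lee_fin -rprobE//.
have cvgF : nu \o F @ \oo --> nu (\bigcup_n F n).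
  apply: nondecreasing_cvg_mu => // n m nm; apply/subsetPset => x [i [lt Di]].
  by exists i; split => //; exact: leq_trans nm.
rewrite -(cvg_lim _ cvgF)//; apply: lime_le.
  by apply/cvg_ex; eexists; exact: cvgF.
apply: nearW => n /=; rewrite rprobE// lee_fin.
have [->|[i Fi]] := Ft n; first by rewrite /rprob measure0.
exact: le_trans (le_rprob (mF n) (mD i) Fi) (Dt i).
Qed.

End RealProbability.

(** Open right rays form a generating pi-system, on which the law of [f] is compared with Lebesgue
    measure restricted to the unit interval. Rays starting outside this interval are trivial for
    both. *)
Lemma uniform_law (R : realType) d (Z : measurableType d)
    (nu : probability Z R) (f : Z -> measurableTypeR R) :
  (forall x, 0 <= f x <= 1) ->
  (forall t, measurable [set x | t < f x]) ->
  (forall t, 0 <= t <= 1 -> rprob nu [set x | t < f x] = 1 - t) ->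
  measurable_fun setT f /\
  forall B : set (measurableTypeR R), measurable B ->
    nu (f @^-1` B) = lebesgue_measure (B `&` `[0, 1]%classic).
Proof.
move=> f01 mf law.
have mfun : measurable_fun setT f.
  apply: (measurability _ (measurable_realfun.RGenOInfty.measurableE R)).
  move=> _ [_ [t ->] <-]; rewrite setTI.
  rewrite (_ : _ @^-1` _ = [set x | t < f x])//.
  by apply/seteqP; split => x /=; rewrite in_itv/= andbT.
have mI : measurable (`[0, 1]%classic : set (measurableTypeR R)).
  exact: measurable_itv.
split => // B mB.
pose X : {mfun Z >-> measurableTypeR R} :=
  HB.pack f (isMeasurableFun.Build _ _ _ _ f mfun).
pose m1 : {measure set (measurableTypeR R) -> \bar R} := distribution nu X.
pose m2 : {measure set (measurableTypeR R) -> \bar R} :=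
  mrestr (@lebesgue_measure R) mI.
change (m1 B = m2 B).
have fX t : X @^-1` `]t, +oo[%classic = [set x | t < f x].
  by apply/seteqP; split => x /=; rewrite in_itv/= andbT.
have mu := @measure_unique _ R (measurableTypeR R) (@measurable_realfun.RGenOInfty.G R)
  (fun k => `](- k%:R), +oo[%classic) (measurable_realfun.RGenOInfty.measurableE R).
apply: (mu _ _ _ m1 m2).
- move=> _ _ [x ->] [y ->]; exists (Num.max x y).
  by apply/seteqP; split => z /=; rewrite !in_itv/= !andbT gt_max;
    [case=> -> ->|move/andP].
- by move=> k; exists (- k%:R).
- rewrite -subTset => x _; exists (Num.truncn `|x|).+1 => //=.
  rewrite in_itv/= andbT ltrNl (le_lt_trans (ler_norm _))// normrN.
  exact: truncnS_gt.
- move=> _ [t ->].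
  change (nu (X @^-1` `]t, +oo[%classic) =
    lebesgue_measure (`]t, +oo[%classic `&` `[0, 1]%classic)).
  rewrite fX rprobE//.
  have [t0|t0] := ltP t 0.
    rewrite (_ : [set x | _] = setT) /rprob ?probability_setT; last first.
      apply/seteqP; split => // x _ /=; apply: lt_le_trans t0 _.
      by have /andP[] := f01 x.
    rewrite (_ : _ `&` _ = `[0, 1]%classic).
      by rewrite lebesgue_measure_itv/= lte_fin ltr01 sube0.
    apply/seteqP; split => x /=; rewrite !in_itv/= ?andbT; first by case.
    by move=> /andP[x0 x1]; rewrite x0 x1; split => //; exact: lt_le_trans x0.
  have [t1|t1] := leP t 1; last first.
    rewrite (_ : [set x | _] = set0) /rprob ?measure0; last first.
      rewrite -subset0 => x /= tx; have /andP[_] := f01 x.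
      by rewrite leNgt (lt_trans t1 tx).
    rewrite (_ : _ `&` _ = set0) ?measure0//.
    rewrite -subset0 => x /=; rewrite !in_itv/= ?andbT => -[tx /andP[_ x1]].
    by move: (lt_le_trans tx x1); rewrite ltNge (ltW t1).
  rewrite law ?t0//.
  rewrite (_ : _ `&` _ = `]t, 1]%classic).
    rewrite lebesgue_measure_itv/= lte_fin; case: ltP => //.
    by move=> t1'; rewrite (@le_anti _ _ t 1) ?t1// subrr.
  apply/seteqP; split => x /=; rewrite !in_itv/= ?andbT.
    by move=> [-> /andP[_ ->]].
  by move=> /andP[tx ->]; rewrite tx (le_trans t0 (ltW tx)).
- by move=> k; rewrite ltey_eq fin_num_measure.
- by [].
Qed.

(** * The lexicographic coordinate *)

Section Lexicographic.
Local Open Scope nat_scope.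
Context (Z : Type) (c : nat -> Z -> nat).

Definition before (n : nat) (y x : Z) : Prop :=
  exists k, [/\ k <= n, forall i, i < k -> c i y = c i x & c k y < c k x].

Definition lex_lt (y x : Z) : Prop := exists n, before n y x.

Context (l : nat -> Z -> nat).
Context (cl : forall n x y,
  (forall i, i <= n -> c i x = c i y) <-> l n x = l n y).

Lemma label_mono n m x y : n <= m -> l m x = l m y -> l n x = l n y.
Proof.
move=> nm /cl h; apply/cl => i le_in; apply: h; exact: leq_trans nm.
Qed.

Lemma before_mono n m y x : n <= m -> before n y x -> before m y x.
Proof. by move=> nm [k [kn ? ?]]; exists k; split => //; exact: leq_trans nm. Qed.

Lemma before_irr n y x : l n y = l n x -> ~ before n y x.
Proof. by move=> /cl h [k [kn _]]; rewrite h// ltnn. Qed.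

Lemma before_trans n y x z : before n y x -> before n x z -> before n y z.
Proof.
move=> [k [kn hk ck]] [m [mn hm cm]].
have [km|mk|km] := ltngtP k m.
- exists k; split => // [i ik|]; last by rewrite -hm.
  by rewrite hk// hm// (ltn_trans ik).
- exists m; split => // [i im|]; last by rewrite hk.
  by rewrite hk ?hm// (ltn_trans im).
- exists k; split => // [i ik|]; first by rewrite hk// hm// -km.
  by rewrite (ltn_trans ck)// km.
Qed.

Lemma before_eql n x y z : l n x = l n y -> before n y z -> before n x z.
Proof.
move=> /cl h [k [kn hk ck]]; exists k; split => // [i ik|]; last by rewrite h.
by rewrite h ?hk//; exact: leq_trans (ltnW ik) kn.
Qed.

Lemma before_eqr n x y z : l n y = l n z -> before n x y -> before n x z.
Proof.
move=> /cl h [k [kn hk ck]]; exists k; split => // [i ik|]; last by rewrite -h.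
by rewrite -h ?hk//; exact: leq_trans (ltnW ik) kn.
Qed.

Lemma before_total n y x : [\/ l n y = l n x, before n y x | before n x y].
Proof.
have [e|/cl ne] := pselect (l n y = l n x); first exact: Or31.
pose Q i := i <= n /\ c i y <> c i x.
have ex : exists i, Q i.
  apply: contrapT => nex; apply: ne => i le_in; apply: contrapT => ?.
  by apply: nex; exists i.
have [[kn ck] kmin] := first_indexP ex.
have eqk i : i < first_index Q -> c i y = c i x.
  move=> ik; apply: contrapT => ?; apply: (kmin i ik); split => //.
  exact: leq_trans (ltnW ik) kn.
have [lt|lt|//] := ltngtP (c (first_index Q) y) (c (first_index Q) x).
- by apply: Or32; exists (first_index Q).
- by apply: Or33; exists (first_index Q); split => // i /eqk.
Qed.

Lemma lex_lt_weak n y x : lex_lt y x -> l n y = l n x \/ before n y x.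
Proof.
move=> [m b]; have [mn|nm] := leqP m n; first by right; exact: before_mono b.
have [|?|b'] := before_total n y x; [by left|by right|].
case: (@before_irr m y y erefl).
exact: before_trans b (before_mono (ltnW nm) b').
Qed.

Context (sep : forall x y, (forall n, l n x = l n y) -> x = y).

Lemma lex_lt_total y x : [\/ y = x, lex_lt y x | lex_lt x y].
Proof.
have [e|/existsNP[n ne]] := pselect (forall n, l n y = l n x).
  by apply: Or31; exact: sep.
by have [//|?|?] := before_total n y x; [apply: Or32|apply: Or33]; exists n.
Qed.

(** A stage and a label name a cell; the cut is the initial segment ending with it, empty if the
    label is not taken. There are only countably many cuts. *)
Definition cut (i : nat * nat) : set Z :=
  [set y | exists z, l i.1 z = i.2 /\ (l i.1 y = l i.1 z \/ before i.1 y z)].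

Lemma cut_initial i y x : lex_lt y x -> cut i x -> cut i y.
Proof.
case: i => n m /= yx [z [lz xz]]; exists z; split => //.
case: xz => [xz|xz]; case: (lex_lt_weak n yx) => [e|b].
- by left; rewrite e.
- by right; exact: before_eqr xz b.
- by right; exact: before_eql e xz.
- by right; exact: before_trans b xz.
Qed.

(** The cut ending with the cell of [y] at a separating stage does it. A strict initial segment is
    thus a countable union of cuts. *)
Lemma lex_lt_cut y x : lex_lt y x <-> exists i, cut i y /\ ~ cut i x.
Proof.
split=> [[n yx]|[i [Cy Cx]]].
  exists (n, l n y); split; first by exists y; split => //; left.
  move=> [z /= [zy [xz|xz]]].
    by apply: (@before_irr n y x) => //; rewrite xz zy.
  apply: (@before_irr n y y) => //.
  exact: before_trans yx (before_eqr zy xz).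
have [yx|//|xy] := lex_lt_total y x; first by rewrite yx in Cy.
by case: Cx; exact: cut_initial xy Cy.
Qed.

Lemma cut_chain i j : cut i `<=` cut j \/ cut j `<=` cut i.
Proof.
have [|/existsNP[x /not_implyP[Cx Nx]]] := pselect (cut i `<=` cut j); first by left.
right => y Cy; have [->//|yx|xy] := lex_lt_total y x.
  exact: cut_initial yx Cx.
by case: Nx; exact: cut_initial xy Cy.
Qed.

End Lexicographic.

(** * The coordinate map and its law *)

Section Coordinate.
Context (R : realType) d (Z : measurableType d) (nu : probability Z R).
Context (c l : nat -> Z -> nat).
Context (mc : forall n, measurable_fibers (c n)).
Context (ml : forall n, measurable_fibers (l n)).
Context (cl : forall n x y,
  (forall i, (i <= n)%N -> c i x = c i y) <-> l n x = l n y).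
Context (sep : forall x y, (forall n, l n x = l n y) -> x = y).
Context (m1 : forall x : Z, measurable [set x]).
Context (nu1 : forall x : Z, nu [set x] = 0%E).

Local Notation P := (rprob nu).

Definition coord (x : Z) : R := P [set y | lex_lt c y x].
(** [lo] and [hi] are the ends between which [coord] takes its values on the stage-[n] cell of [z];
    they differ by the mass of the cell. *)
Definition lo n (z : Z) : R := P [set y | before c n y z].
Definition hi n (z : Z) : R := P [set y | l n y = l n z \/ before c n y z].

Lemma measurable_cell n z : measurable [set y | l n y = l n z].
Proof. exact: ml. Qed.

Lemma measurable_before n z : measurable [set y | before c n y z].
Proof.
rewrite (_ : [set y | _] = [set y | exists k, (k <= n)%N /\
  ((forall i, (i < k)%N -> c i y = c i z) /\ (c k y < c k z)%N)]).
  apply: measurable_exists => k; apply: measurable_and.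
    exact: measurable_const.
  apply: measurable_and; last first.
    exact: (measurable_fibers_preimage (fun m => (m < c k z)%N : Prop)).
  apply: measurable_forall => i; apply: measurable_imply.
    exact: measurable_const.
  exact: mc.
by apply/seteqP; split => y /= [k]; [case|case=> ? []]; exists k.
Qed.

Lemma measurable_before_eq n z :
  measurable [set y | l n y = l n z \/ before c n y z].
Proof.
exact: measurableU (measurable_cell n z) (measurable_before n z).
Qed.

Lemma measurable_lex_lt z : measurable [set y | lex_lt c y z].
Proof. by apply: measurable_exists => n; exact: measurable_before. Qed.

Lemma measurable_cut i : measurable (cut c l i).
Proof.
have [[z lz]|ne] := pselect (exists z, l i.1 z = i.2).
  rewrite (_ : cut c l i = [set y | l i.1 y = l i.1 z \/ before c i.1 y z]).
    exact: measurable_before_eq.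
  apply/seteqP; split => y /=; last by exists z.
  move=> [z' [lz' [->|b]]]; first by left; rewrite lz' lz.
  by right; apply: before_eqr b; [exact: cl|rewrite lz' lz].
rewrite (_ : cut c l i = set0); first exact: measurable0.
by rewrite -subset0 => y [z [lz _]]; apply: ne; exists z.
Qed.

Lemma hiE n z : hi n z = P [set y | l n y = l n z] + lo n z.
Proof.
rewrite /hi /lo -rprobU; [by []|exact: measurable_cell|exact: measurable_before|].
by rewrite -subset0 => y [/= e b]; exact: (before_irr cl e b).
Qed.

Lemma lo_ge0 n z : 0 <= lo n z. Proof. exact: rprob_ge0. Qed.

Lemma hi_le1 n z : hi n z <= 1.
Proof. by apply: rprob_le1; exact: measurable_before_eq. Qed.

Lemma lo_mono n m z : (n <= m)%N -> lo n z <= lo m z.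
Proof.
move=> nm; apply: le_rprob; [exact: measurable_before..|].
by move=> y; exact: before_mono.
Qed.

Lemma hi_mono n m z : (n <= m)%N -> hi m z <= hi n z.
Proof.
move=> nm; apply: le_rprob; [exact: measurable_before_eq..|] => y [e|b].
  by left; exact: label_mono e.
by apply: (lex_lt_weak cl); exists m.
Qed.

Lemma hi_le_lo n x z : before c n x z -> hi n x <= lo n z.
Proof.
move=> xz; apply: le_rprob.
- exact: measurable_before_eq.
- exact: measurable_before.
- by move=> y [e|b]; [exact: before_eql e xz|exact: before_trans b xz].
Qed.

Lemma lo_eq n x z : l n x = l n z -> lo n x = lo n z.
Proof.
move=> e; congr (P _); apply/seteqP; split => y /=; exact: before_eqr.
Qed.

Lemma hi_eq n x z : l n x = l n z -> hi n x = hi n z.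
Proof.
by move=> e; rewrite !hiE (lo_eq e); congr (P _ + _); apply/seteqP;
  split => y /=; rewrite e.
Qed.

Lemma lo_le_coord n x : lo n x <= coord x.
Proof.
apply: le_rprob; [exact: measurable_before|exact: measurable_lex_lt|].
by move=> y b; exists n.
Qed.

Lemma coord_le_hi n x : coord x <= hi n x.
Proof.
apply: le_rprob; [exact: measurable_lex_lt|exact: measurable_before_eq|].
by move=> y; exact: (lex_lt_weak cl).
Qed.

Lemma coord01 x : 0 <= coord x <= 1.
Proof. by rewrite rprob_ge0 rprob_le1//; exact: measurable_lex_lt. Qed.

(** Intervals of distinct cells of one stage are ordered and share at most an end, so strict
    inequalities single out the cell. *)
Lemma coord_inside n x z : lo n z < coord x < hi n z -> l n x = l n z.
Proof.
move=> /andP[lx xh]; have [//|/hi_le_lo h|/hi_le_lo h] := before_total cl n x z.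
  by move: (lt_le_trans lx (le_trans (coord_le_hi n x) h)); rewrite ltxx.
by move: (lt_le_trans xh (le_trans h (lo_le_coord n x))); rewrite ltxx.
Qed.

(** At the coarser of the two stages, either the cells agree and one contains the other, or they are
    ordered; monotonicity of [lo] and [hi] then carries the order to the finer stage. *)
Lemma disjoint_cells n m z w : ~ (exists x, l n x = l n z /\ l m x = l m w) ->
  hi n z <= lo m w \/ hi m w <= lo n z.
Proof.
move=> ne; pose k := minn n m.
have [kn km] : (k <= n)%N /\ (k <= m)%N by rewrite geq_minl geq_minr.
have [e|b|b] := before_total cl k z w.
- case: ne; have [nm|mn] := leqP n m.
    by exists w; split => //; move: e; rewrite /k (minn_idPl nm).
  by exists z; split => //; move: e; rewrite /k (minn_idPr (ltnW mn)).
- left; apply: (le_trans (hi_mono _ kn)).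
  exact: le_trans (hi_le_lo b) (lo_mono _ km).
- right; apply: (le_trans (hi_mono _ km)).
  exact: le_trans (hi_le_lo b) (lo_mono _ kn).
Qed.

(** The second term is the position inside the cell, the part that [U] will preserve. *)
Lemma coord_split n x :
  coord x = lo n x + P [set y | l n y = l n x /\ lex_lt c y x].
Proof.
rewrite /coord /lo -rprobU; first congr (P _).
- apply/seteqP; split => y /=.
    by move=> yx; have [e|b] := lex_lt_weak cl n yx; [right|left].
  by case=> [b|[]//]; exists n.
- exact: measurable_before.
- by apply: measurable_and; [exact: ml|exact: measurable_lex_lt].
- by rewrite -subset0 => y [/= b [e _]]; exact: (before_irr cl e b).
Qed.

(** [coord x] is the supremum of the masses of the cuts that miss [x], because these form a chain.
    The description is countable, hence measurable. *)
Lemma coord_gtE t : 0 <= t -> [set x | t < coord x] =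
  [set x | exists i, t < P (cut c l i) /\ ~ cut c l i x].
Proof.
move=> t0; apply/seteqP; split => x /=; last first.
  move=> [i [ti nx]]; apply: (lt_le_trans ti).
  apply: le_rprob; [exact: measurable_cut|exact: measurable_lex_lt|].
  by move=> y Cy; apply/(lex_lt_cut cl sep); exists i.
rewrite ltNge => /negP tx; apply: contrapT => nex; apply: tx.
pose D i := [set y | cut c l i y /\ ~ cut c l i x].
rewrite /coord (_ : [set y | _] = [set y | exists i, D i y]); last first.
  by apply/seteqP; split => y /= /(lex_lt_cut cl sep).
have mD i : measurable (D i).
  by apply: measurable_and; [exact: measurable_cut|exact: measurable_const].
apply: rprob_chain_le => // [i j|i].
  have [xi|nxi] := pselect (cut c l i x).
    by left => y [_ /(_ xi)].
  have [xj|nxj] := pselect (cut c l j x).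
    by right => y [_ /(_ xj)].
  by have [s|s] := cut_chain cl sep i j; [left|right] => y [/s].
rewrite leNgt; apply/negP => ti.
have [xi|nxi] := pselect (cut c l i x).
  move: ti; rewrite (_ : D i = set0) /rprob ?measure0 ?ltNge ?t0//.
  by rewrite -subset0 => y [_ /(_ xi)].
apply: nex; exists i; split => //; apply: (lt_le_trans ti).
by apply: le_rprob => //; [exact: measurable_cut|move=> y []].
Qed.

Lemma measurable_coord_gt t : measurable [set x | t < coord x].
Proof.
have [t0|t0] := ltP t 0.
  rewrite (_ : [set x | _] = setT)//; apply/seteqP; split => // x _.
  by apply: (lt_le_trans t0); exact: rprob_ge0.
rewrite coord_gtE//; apply: measurable_exists => i; apply: measurable_and.
  exact: measurable_const.
by apply: measurable_not; exact: measurable_cut.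
Qed.

(** For the upper bound, the set is the union of a chain of complements of cuts with mass above [t].
    For the lower bound, its complement is shown to have mass at most [t]. *)
Lemma coord_law t : 0 <= t <= 1 -> P [set x | t < coord x] = 1 - t.
Proof.
move=> /andP[t0 t1].
have mX := measurable_coord_gt t.
apply/le_anti/andP; split.
  rewrite coord_gtE//.
  pose D i := [set y | t < P (cut c l i) /\ ~ cut c l i y].
  have mD i : measurable (D i).
    apply: measurable_and; first exact: measurable_const.
    by apply: measurable_not; exact: measurable_cut.
  apply: (@rprob_chain_le _ _ _ _ _ D) => // [i j||i]; last first.
  - have [ti|ti] := ltP t (P (cut c l i)).
      rewrite (_ : D i = ~` cut c l i); last by apply/seteqP; split => y // [].
      by rewrite rprob_setC ?lerB ?(ltW ti)//; exact: measurable_cut.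
    rewrite (_ : D i = set0) /rprob ?measure0 ?subr_ge0//.
    by rewrite -subset0 => y [+ _]; rewrite ltNge ti.
  - by rewrite subr_ge0.
  have [ti|ti] := ltP t (P (cut c l i)); last first.
    by left => y [+ _]; rewrite ltNge ti.
  have [tj|tj] := ltP t (P (cut c l j)); last first.
    by right => y [+ _]; rewrite ltNge tj.
  by have [s|s] := cut_chain cl sep i j; [right|left] => y [_ h]; split => // /s.
(* Off its maximum, a point of the segment [coord <= t] lies in a cut that
   misses a larger point of the segment. *)
pose X := ~` [set x | t < coord x].
have mX' : measurable X by exact: measurableC.
suff : P X <= t by rewrite rprob_setC// => h; rewrite lerBlDl -lerBlDr.
pose D i := [set y | (exists x, X x /\ ~ cut c l i x) /\ cut c l i y].
have mD i : measurable (D i).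
  by apply: measurable_and; [exact: measurable_const|exact: measurable_cut].
pose E := [set y | exists i, D i y].
have mE : measurable E by exact: measurable_exists.
have PE : P E <= t.
  apply: rprob_chain_le => // [i j|i].
    have [xi|nxi] := pselect (exists x, X x /\ ~ cut c l i x); last by left => y [].
    have [xj|nxj] := pselect (exists x, X x /\ ~ cut c l j x); last by right => y [].
    by have [s|s] := cut_chain cl sep i j; [left|right] => y [_ /s].
  have [[x [Xx nx]]|nx] := pselect (exists x, X x /\ ~ cut c l i x); last first.
    by rewrite (_ : D i = set0) /rprob ?measure0//; rewrite -subset0 => y [].
  have /negP := Xx; rewrite -leNgt; apply: le_trans.
  apply: le_rprob => //; first exact: measurable_lex_lt.
  by move=> y [_ Cy]; apply/(lex_lt_cut cl sep); exists i.
have [[w [Xw wE]]|nw] := pselect (exists w, X w /\ ~ E w); last first.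
  apply: le_trans PE; apply: le_rprob => // x Xx.
  by apply: contrapT => nE; apply: nw; exists x.
have Ew0 : P [set w] = 0 by rewrite /rprob nu1.
(* Of two distinct points of [X] outside [E], the smaller would lie in a cut missing the larger and
   so in [E]. Only the null point [w] is left out. *)
have sub : X `<=` E `|` [set w].
  move=> x Xx; have [|nE] := pselect (E x); first by left.
  right; have notlt u v : X u -> X v -> ~ E u -> ~ lex_lt c u v.
    move=> Xu Xv Eu /(lex_lt_cut cl sep)[i [Cu Cv]]; apply: Eu.
    by exists i; split => //; exists v.
  have [//|xw|wx] := lex_lt_total cl sep x w.
    by case: (notlt _ _ Xx Xw nE).
  by case: (notlt _ _ Xw Xx wE).
apply: (le_trans (le_rprob nu mX' (measurableU _ _ mE (m1 w)) sub)).
rewrite rprobU// ?Ew0 ?addr0//.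
by rewrite -subset0 => x [Ex xw]; apply: wE; rewrite -xw.
Qed.

Lemma coord_uniform :
  measurable_fun setT (coord : Z -> measurableTypeR R) /\
  forall B : set (measurableTypeR R), measurable B ->
    nu (coord @^-1` B) = lebesgue_measure (B `&` `[0, 1]%classic).
Proof.
by apply: uniform_law; [exact: coord01|exact: measurable_coord_gt|exact: coord_law].
Qed.

End Coordinate.

(** * Borel maps into a complete metric space *)

Section MetricBalls.
Context (R : realType) (P : metricType R).

Lemma metric_ball_open (x : P) (r : R) : open (ball x r).
Proof.
rewrite openE => y xy; apply/nbhs_ballP; exists (r - mdist x y) => /=.
  by rewrite subr_gt0; move: xy; rewrite ballEmdist.
move=> z; move: xy; rewrite !ballEmdist/= => xy; rewrite ltrBrDl => yz.
exact: le_lt_trans (metric_triangle x y z) yz.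
Qed.

Lemma invS_gt0 k : 0 < k.+1%:R^-1 :> R.
Proof. by rewrite invr_gt0. Qed.

Lemma le_invS k j : (k <= j)%N -> j.+1%:R^-1 <= k.+1%:R^-1 :> R.
Proof. by move=> kj; rewrite lef_pV2 ?posrE// ler_nat ltnS. Qed.

Lemma small_invS (e : R) : 0 < e -> exists k, k.+1%:R^-1 < e.
Proof.
move=> e0; exists (Num.truncn e^-1).
by rewrite invf_plt ?posrE// truncnS_gt.
Qed.

Lemma dense_sequence (D : set P) (p0 : P) : countable D -> dense D ->
  exists q : nat -> P, forall x k, exists i, ball (q i) k.+1%:R^-1 x.
Proof.
move=> /pfcard_geP[->|[q]] dD.
  by have [||x []] := dD setT; [exists p0|exact: openT|].
exists q => x k.
have [||y [xy Dy]] := dD (ball x k.+1%:R^-1); [|exact: metric_ball_open|].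
  by exists x; rewrite ballEmdist/= mdistxx invS_gt0.
have [i _ iy] := 'surj_q Dy.
by exists i; rewrite iy; exact: ball_sym.
Qed.

(** The explicit modulus locates the limit from any single term of the sequence. *)
Lemma fast_cauchy_limit (u : nat -> P) :
  (forall F : set_system P, ProperFilter F -> cauchy F -> exists p : P, F --> p) ->
  (forall k j, (k <= j)%N -> mdist (u k) (u j) < 2 * k.+1%:R^-1) ->
  exists p, forall k, mdist (u k) p <= 2 * k.+1%:R^-1.
Proof.
move=> complete fast.
have [|p up] := complete (u @ \oo) _.
  apply/cauchyP => e e0; have [k ke] := small_invS (divr_gt0 e0 (ltr0Sn R 1)).
  exists (u k); exists k => // j /= kj; rewrite ballEmdist/=.
  by apply: (lt_trans (fast _ _ kj)); rewrite mulrC -ltr_pdivlMr.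
exists p => k; apply/ler_addgt0Pr => e e0.
have /cvg_ballP/(_ e e0)[n _ nu] := up.
have := nu (maxn n k) (leq_maxl _ _); rewrite ballEmdist/= metric_sym => pu.
apply: (le_trans (metric_triangle _ (u (maxn n k)) _)).
by rewrite lerD// ltW//; exact: fast (leq_maxr _ _).
Qed.

Lemma mdist_invS_eq (x y : P) (m : nat) :
  (forall k, mdist x y <= m%:R * k.+1%:R^-1) -> x = y.
Proof.
move=> h; apply: mdist_positivity; apply/le_anti/andP; split; last exact: mdist_ge0.
apply/ler_addgt0Pr => e e0; rewrite add0r.
have m0 : 0 < m.+1%:R :> R by [].
have [k ke] := small_invS (divr_gt0 e0 m0).
apply: (le_trans (h k)); apply: (@le_trans _ _ (m.+1%:R * k.+1%:R^-1)).
  by rewrite ler_wpM2r ?ler_nat// ltW// invS_gt0.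
by rewrite mulrC -ler_pdivlMr// ltW.
Qed.

End MetricBalls.

(** * Reconstructing a point from the balls that contain it *)

Section LeftInverse.
Context (R : realType) (P : metricType R) (q : nat -> P).
Context (complete : forall F : set_system P, ProperFilter F -> cauchy F ->
  exists p : P, F --> p).
Context dT (T : measurableType dT) (E : nat -> nat -> T -> Prop).
Context (mE : forall i k, measurable [set t | E i k t]) (p0 : P).

(** If no ball of scale [k] is named at [t], every index qualifies and the value is 0, so a first
    index always exists. *)
Let center k t := first_index (fun i => E i k t \/ ~ exists j, E j k t).

(** The factor 2 comes from two balls, of radius at most [k.+1%:R^-1], around a common point. *)
Let coherent t := (forall k, exists i, E i k t) /\
  forall k j, (k <= j)%N ->
    mdist (q (center k t)) (q (center j t)) < 2 * k.+1%:R^-1.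

Let limit t : P :=
  if pselect (exists p, coherent t /\
    forall k, mdist (q (center k t)) p <= 2 * k.+1%:R^-1) is left e
  then projT1 (cid e) else p0.

Let measurable_center k : measurable_fibers (center k).
Proof.
apply: measurable_fibers_first_index => [t|i].
  have [[j Ej]|nE] := pselect (exists j, E j k t); first by exists j; left.
  by exists 0%N; right.
by apply: measurableU; [exact: mE|apply: measurable_not; exact: measurable_exists].
Qed.

Let measurable_coherent : measurable [set t | coherent t].
Proof.
apply: measurable_and.
  by apply: measurable_forall => k; exact: measurable_exists.
apply: measurable_forall => k; apply: measurable_forall => j.
apply: measurable_imply; first exact: measurable_const.
exact: (measurable_fibers_preimage
  (fun i => mdist (q i.1) (q i.2) < 2 * k.+1%:R^-1 : Prop)
  (measurable_fibers_pair (measurable_center k) (measurable_center j))).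
Qed.

Let limitP t : coherent t ->
  forall k, mdist (q (center k t)) (limit t) <= 2 * k.+1%:R^-1.
Proof.
move=> ct; rewrite /limit; case: pselect => [e|[]].
  by case: (projT2 (cid e)).
have [p hp] := fast_cauchy_limit complete ct.2.
by exists p.
Qed.

(** The limit is within 2 radii of the center, hence inside the ball of 3 radii. Conversely this
    ball stays within 5 radii of the limit, whence [e / 5]. Only countably many balls occur. *)
Let limit_open (O : set P) : open O -> measurable [set t | O (limit t)].
Proof.
move=> oO; rewrite (_ : [set t | _] = [set t |
   (coherent t /\ exists k, ball (q (center k t)) (3 * k.+1%:R^-1) `<=` O)
   \/ (~ coherent t /\ O p0)]).
  apply: measurableU; apply: measurable_and.
  - exact: measurable_coherent.
  - apply: measurable_exists => k.
    exact: (measurable_fibers_preimage (fun i => ball (q i) (3 * k.+1%:R^-1) `<=` O)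
      (measurable_center k)).
  - exact: measurable_not measurable_coherent.
  - exact: measurable_const.
have nc t : ~ coherent t -> limit t = p0.
  by rewrite /limit; case: pselect => // -[? []].
apply/seteqP; split => t /=.
  have [ct|ct] := pselect (coherent t); last by rewrite nc//; right.
  move=> Ot; left; split => //.
  have /nbhs_ballP[e /= e0 eO] := open_nbhs_nbhs (conj oO Ot).
  have e5 : 0 < e / 5 by rewrite divr_gt0.
  have [k ke] := small_invS e5.
  exists k => y; rewrite ballEmdist/= => qy; apply: eO; rewrite ballEmdist/=.
  apply: (le_lt_trans (metric_triangle _ (q (center k t)) _)).
  have := limitP ct k; rewrite metric_sym => h.
  move: ke qy h; set v := k.+1%:R^-1; set a := mdist _ y; set b := mdist _ _.
  by rewrite ltr_pdivlMr//; lra.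
case=> [[ct [k kO]]|[ct Op]]; last by rewrite nc.
apply: kO; rewrite ballEmdist/=; apply: (le_lt_trans (limitP ct k)).
by rewrite ltr_pM2r ?invS_gt0// ltr_nat.
Qed.

Let limit_borel (S : set P) : <<s @open P >> S -> measurable [set t | S (limit t)].
Proof.
move=> /(_ [set S | measurable [set t | S (limit t)]]); apply; split.
  split => [|A mA|F mF]; first exact: measurable_const.
  - change (measurable [set t | (setT `\` A) (limit t)]).
    rewrite (_ : [set t | _] = [set t | ~ A (limit t)]).
      exact: measurable_not.
    by apply/seteqP; split => t /=; [case|].
  - change (measurable [set t | (\bigcup_i F i) (limit t)]).
    rewrite (_ : [set t | _] = \bigcup_i [set t | F i (limit t)]).
      exact: bigcupT_measurable.
    by apply/seteqP; split => t [i _ Fi]; exists i.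
by move=> O /limit_open.
Qed.

(** The centers are within one radius of [p] and within two of the limit, which gives the constant
    3. *)
Let limit_eq t p : (forall i k, E i k t <-> ball (q i) k.+1%:R^-1 p) ->
  (forall k, exists i, ball (q i) k.+1%:R^-1 p) -> limit t = p.
Proof.
move=> Eb bp.
have near k : mdist (q (center k t)) p < k.+1%:R^-1.
  have [i ip] := bp k.
  have [|[|[]]] := @first_indexP (fun i => E i k t \/ ~ exists j, E j k t).
  - by exists i; left; apply/Eb.
  - by move=> /Eb; rewrite ballEmdist.
  - by exists i; apply/Eb.
have ct : coherent t.
  split => [k|k j kj]; first by have [i /Eb] := bp k; exists i.
  apply: (le_lt_trans (metric_triangle _ p _)); rewrite [mdist p _]metric_sym.
  have := near k; have := near j; have := le_invS R kj.
  set v := k.+1%:R^-1; set w := j.+1%:R^-1; lra.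
apply: (@mdist_invS_eq _ _ _ _ 3) => k.
apply: (le_trans (metric_triangle _ (q (center k t)) _)); rewrite metric_sym.
have := limitP ct k; have := ltW (near k).
by set v := k.+1%:R^-1; lra.
Qed.

Lemma borel_limit : exists psi : T -> P,
  (forall S : set P, <<s @open P >> S -> measurable [set t | S (psi t)]) /\
  forall t p, (forall i k, E i k t <-> ball (q i) k.+1%:R^-1 p) ->
    (forall k, exists i, ball (q i) k.+1%:R^-1 p) -> psi t = p.
Proof. by exists limit; split; [exact: limit_borel|exact: limit_eq]. Qed.

End LeftInverse.

(** * Cells and translations *)

Section Cells.
Context (R : realType) d (Z : measurableType d) (nu : probability Z R).
Context (c l : nat -> Z -> nat).
Context (mc : forall n, measurable_fibers (c n)).
Context (ml : forall n, measurable_fibers (l n)).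
Context (cl : forall n x y,
  (forall i, (i <= n)%N -> c i x = c i y) <-> l n x = l n y).
Context (sep : forall x y, (forall n, l n x = l n y) -> x = y).
Context (m1 : forall x : Z, measurable [set x]).
Context (nu1 : forall x : Z, nu [set x] = 0%E).

Local Notation Phi := (coord nu c : Z -> measurableTypeR R).
Local Notation lo := (lo nu c).
Local Notation hi := (hi nu c l).

Lemma lebesgue_null_image (B : set (measurableTypeR R)) (N : set Z) :
  measurable B -> B `<=` `[0, 1]%classic -> measurable N -> nu N = 0%E ->
  Phi @^-1` B `<=` N -> lebesgue_measure B = 0%E.
Proof.
move=> mB B01 mN N0 BN; have [mPhi law] := coord_uniform mc ml cl sep m1 nu1.
rewrite -[B](setIidl B01) -law//; apply: null_subset BN N0 => //.
by rewrite -[_ @^-1` _]setTI; exact: mPhi.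
Qed.

Definition cell_bound (i : nat * nat * bool) : R :=
  if pselect (exists z, l i.1.1 z = i.1.2) is left e then
    let z := projT1 (cid e) in if i.2 then hi i.1.1 z else lo i.1.1 z
  else 0.

Lemma cell_boundE n z b :
  cell_bound (n, l n z, b) = if b then hi n z else lo n z.
Proof.
rewrite /cell_bound /=; case: pselect => [e|[]]; last by exists z.
by case: (cid e) => w /= wz; rewrite (lo_eq nu cl wz) (hi_eq nu mc ml cl wz).
Qed.

Definition endpoint (x : Z) := exists i, Phi x = cell_bound i.

Lemma measurable_level (a : R) : measurable [set x | Phi x = a].
Proof.
have [mPhi _] := coord_uniform mc ml cl sep m1 nu1.
rewrite (_ : [set x | _] = setT `&` Phi @^-1` [set a]); last first.
  by rewrite setTI.
by apply: mPhi => //; exact: measurable_set1.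
Qed.

Lemma measurable_endpoint : measurable [set x | endpoint x].
Proof. by apply: measurable_exists => i; exact: measurable_level. Qed.

(** The law is uniform, so each level of [Phi] is null, and there are countably many bounds. *)
Lemma endpoint_null : nu [set x | endpoint x] = 0%E.
Proof.
have [mPhi law] := coord_uniform mc ml cl sep m1 nu1.
apply: null_exists => i; first exact: measurable_level.
have := law [set cell_bound i] (measurable_set1 _).
rewrite (_ : _ @^-1` _ = [set x | Phi x = cell_bound i])// => ->.
apply/eqP; rewrite eq_le measure_ge0 andbT -(lebesgue_measure_set1 (cell_bound i)).
apply: le_measure; rewrite ?inE; last exact: subIsetl.
  by apply: measurableI; [exact: measurable_set1|exact: measurable_itv].
exact: measurable_set1.
Qed.

Lemma coord_in_cell n x : ~ endpoint x -> lo n x < Phi x < hi n x.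
Proof.
move=> ne; rewrite !lt_neqAle (lo_le_coord nu mc)//.
rewrite (coord_le_hi nu mc ml cl) !andbT.
apply/andP; split; apply/eqP => e; apply: ne.
  by exists (n, l n x, false); rewrite cell_boundE -e.
by exists (n, l n x, true); rewrite cell_boundE.
Qed.

(** A Borel substitute for the image under [Phi] of a union [A] of stage-[n] cells. *)
Definition cell_union n (A : set Z) : set (measurableTypeR R) :=
  [set t | exists m, (exists z, l n z = m /\ A z) /\
     (cell_bound (n, m, false) < t < cell_bound (n, m, true))].

Lemma measurable_cell_union n A : measurable (cell_union n A).
Proof.
apply: measurable_exists => m; apply: measurable_and.
  exact: measurable_const.
rewrite (_ : [set t | _] =
  `]cell_bound (n, m, false), cell_bound (n, m, true)[%classic).
  exact: measurable_itv.
by apply/seteqP; split => t /=; rewrite in_itv.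
Qed.

Lemma cell_unionE n (A : set Z) x : (forall y z, l n y = l n z -> A y -> A z) ->
  ~ endpoint x -> cell_union n A (Phi x) <-> A x.
Proof.
move=> sat ne; split => [[m [[z [<- Az]]]]|Ax].
  rewrite !cell_boundE => /(coord_inside mc ml cl) e.
  by apply: sat Az.
by exists (l n x); split; [exists x|rewrite !cell_boundE coord_in_cell].
Qed.

End Cells.

(** * The automorphism as a translation on cells *)

Section TranslationOnCells.
Context (R : realType) d (Z : measurableType d) (nu : probability Z R).
Context (U V : Z -> Z) (UK : cancel U V) (VK : cancel V U).
Context (mU : measurable_fun setT U) (mV : measurable_fun setT V).
Context (nuU : forall C : set Z, measurable C -> nu (U @^-1` C) = nu C).
Context (A : nat -> set Z) (mA : forall n, measurable (A n)).
Context (A_sep : forall x y, (forall n, A n x <-> A n y) -> x = y).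

Local Notation l := (label U V A).
Local Notation c := (code U V A).
Local Notation stay_ n := (stay U V (marker U V A n)).
Local Notation Phi := (coord nu c).
Local Notation lo := (lo nu c).
Local Notation hi := (hi nu c l).

Let cl := code_label UK VK A.
Let ml := measurable_fibers_label UK VK mU mV mA A_sep.
Let mc := measurable_fibers_code UK VK mU mV mA A_sep.

Lemma label_step n x y : stay_ n x -> l n (U x) = l n (U y) <-> l n x = l n y.
Proof.
move=> sx; split; last exact: label_fwd.
have sx' : stay_ n (V (U x)) by rewrite UK.
by move=> /(label_bwd UK VK sx')[_]; rewrite !UK.
Qed.

(** Digits up to [n] agree inside the cell, before and after [U], and later digits are unchanged by
    [code_stay]; so the deciding digit is the same. *)
Lemma lex_lt_step n x y : stay_ n x -> l n y = l n x ->
  lex_lt c (U y) (U x) <-> lex_lt c y x.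
Proof.
move=> sx yx.
have sy : stay_ n y by apply: label_stay sx.
have ck k z : stay_ n z -> (n < k)%N -> c k (U z) = c k z.
  by move=> sz nk; apply: code_stay nk.
have cn : forall i, (i <= n)%N -> c i y = c i x by apply/cl.
have cUn : forall i, (i <= n)%N -> c i (U y) = c i (U x).
  by apply/cl; rewrite label_step.
split=> -[_ [k [_ hk lt]]]; exists k, k; split => //.
- move=> i ik; have [|ni] := leqP i n; first exact: cn.
  by rewrite -(ck _ _ sy ni) -(ck _ _ sx ni) hk.
- have [kn|nk] := leqP k n; first by move: lt; rewrite cUn// ltnn.
  by rewrite -(ck _ _ sy nk) -(ck _ _ sx nk).
- move=> i ik; have [|ni] := leqP i n; first exact: cUn.
  by rewrite (ck _ _ sy ni) (ck _ _ sx ni) hk.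
- have [kn|nk] := leqP k n; first by move: lt; rewrite cn// ltnn.
  by rewrite (ck _ _ sy nk) (ck _ _ sx nk).
Qed.

(** By [lex_lt_step], [U] pulls the part of the new cell below [U x] back to the part of the old
    cell below [x], so the second term of [coord_split] is unchanged. *)
Lemma coord_step n x : stay_ n x -> Phi (U x) = Phi x + (lo n (U x) - lo n x).
Proof.
move=> sx; rewrite !(coord_split nu mc ml cl n).
set p := rprob _ _; set q := rprob _ _; suff -> : p = q by ring.
rewrite /p /q /rprob -nuU; last first.
  by apply: measurable_and; [exact: ml|exact: measurable_lex_lt].
congr (fine (nu _)); apply/seteqP; split => y /= [].
  move=> /esym/(label_step _ sx)/esym e.
  by rewrite (lex_lt_step sx e).
by move=> e; rewrite (lex_lt_step sx e) => lt; split => //; exact/esym/label_step/esym.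
Qed.

Lemma cell_length_step n x : stay_ n x ->
  hi n (U x) = hi n x + (lo n (U x) - lo n x).
Proof.
move=> sx; rewrite !(hiE nu mc ml cl).
set p := rprob _ _; set q := rprob _ _; suff -> : p = q by ring.
rewrite /p /q /rprob -nuU; last exact: ml.
congr (fine (nu _)); apply/seteqP; split => y /= e; apply/esym.
  exact/(label_step _ sx)/esym.
exact/(label_step _ sx)/esym.
Qed.

(* Taking the first stage at which [U] stays in the block makes the selected
   cells disjoint. *)
Definition selected (k : nat) (nz : nat * Z) : Prop :=
  [/\ pickle (nz.1, l nz.1 nz.2) = k, stay_ nz.1 nz.2 &
      forall j, (j < nz.1)%N -> ~ stay_ j nz.2].

Definition select (k : nat) : option (nat * Z) :=
  if pselect (exists nz, selected k nz) is left e then Some (projT1 (cid e))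
  else None.

Lemma selectP k nz : select k = Some nz -> selected k nz.
Proof. by rewrite /select; case: pselect => // e [<-]; case: (cid e). Qed.

Lemma select_cover x : (exists n, stay_ n x) ->
  exists k nz, select k = Some nz /\ l nz.1 x = l nz.1 nz.2.
Proof.
move=> /first_indexP [sx smin]; set n := first_index _ in sx smin.
exists (pickle (n, l n x)); rewrite /select; case: pselect => [e|[]]; last first.
  by exists (n, x).
case: (cid e) => -[m z] /= [/(pcan_inj pickleK)[-> lz] _ _].
by exists (n, z); split => //; rewrite lz.
Qed.

(** If cells of stages [n <= n'] meet, the finer lies in the coarser, so its points already stay at
    stage [n]; minimality of [n'] makes the stages equal. *)
Lemma select_inj k k' nz nz' : select k = Some nz -> select k' = Some nz' ->
  (exists x, l nz.1 x = l nz.1 nz.2 /\ l nz'.1 x = l nz'.1 nz'.2) -> k = k'.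
Proof.
wlog : k k' nz nz' / (nz.1 <= nz'.1)%N.
  move=> h s s' [x [e e']]; have [le|le] := leqP nz.1 nz'.1.
    by apply: h s s' _ => //; exists x.
  by apply/esym; apply: h s' s _; [exact: ltnW|exists x].
case: nz nz' => [n z] [n' z'] /= le /selectP[/= <- sz _] /selectP[/= <- _ nz'].
move=> [x [e e']]; have e'' : l n x = l n z' by apply: (label_mono cl le).
have sz' : stay_ n z'.
  by apply: (label_stay UK VK e''); exact: (label_stay UK VK (esym e)).
move: le nz' e'; rewrite leq_eqVlt => /orP[/eqP <- _ _|lt /(_ _ lt)//].
by rewrite -e e''.
Qed.

(** An index that names no selected cell yields the empty interval from 0 to 0. *)
Definition cell_a k : R := if select k is Some nz then lo nz.1 nz.2 else 0.
Definition cell_b k : R := if select k is Some nz then hi nz.1 nz.2 else 0.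
Definition cell_d k : R :=
  if select k is Some nz then lo nz.1 (U nz.2) - lo nz.1 nz.2 else 0.

Lemma cell_shift k : [set u + cell_d k | u in `]cell_a k, cell_b k[%classic] =
  if select k is Some nz then `]lo nz.1 (U nz.2), hi nz.1 (U nz.2)[%classic
  else set0.
Proof.
rewrite /cell_a /cell_b /cell_d; case E: select => [[n z]|]; last first.
  rewrite -subset0 => t [u /=]; rewrite in_itv/= => /andP[u0 u1].
  by move: (lt_trans u0 u1); rewrite ltxx.
have [/= _ sz _] := selectP E; rewrite (cell_length_step sz).
apply/seteqP; split => [_ [u /= + <-]|t /=]; rewrite !in_itv/=.
  by move=> /andP[? ?]; apply/andP; split; lra.
move=> /andP[? ?]; exists (t - (lo n (U z) - lo n z)); last by ring.
by rewrite in_itv/=; apply/andP; split; lra.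
Qed.

Lemma open_cell01 n z : `]lo n z, hi n z[%classic `<=` (`[0, 1]%classic : set R).
Proof.
move=> t /=; rewrite !in_itv/= => /andP[t0 t1].
rewrite (le_trans (lo_ge0 _ _ _ _) (ltW t0)).
by rewrite (le_trans (ltW t1) (hi_le1 nu mc ml n z)).
Qed.

Lemma open_cells_disjoint n m z w (t : R) :
  (lo n z < t < hi n z) -> (lo m w < t < hi m w) ->
  exists x, l n x = l n z /\ l m x = l m w.
Proof.
move=> /andP[? ?] /andP[? ?]; apply: contrapT => /(disjoint_cells nu mc ml cl).
by case; lra.
Qed.

Lemma trivIset_cells :
  trivIset setT (fun k => `]cell_a k, cell_b k[%classic : set R).
Proof.
apply/trivIsetP => k k' _ _ /eqP kk'; rewrite -subset0 => t [].
rewrite /cell_a /cell_b /=; case E: select => [nz|]; last first.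
  by rewrite in_itv/= => /andP[u0 u1]; move: (lt_trans u0 u1); rewrite ltxx.
case E': select => [nz'|]; last first.
  by rewrite !in_itv/= => _ /andP[u0 u1]; move: (lt_trans u0 u1); rewrite ltxx.
rewrite !in_itv/= => h h'; apply: kk'; apply: select_inj E E' _.
exact: open_cells_disjoint h h'.
Qed.

Lemma trivIset_shifted_cells : trivIset setT
  (fun k => [set u + cell_d k | u in `]cell_a k, cell_b k[%classic] : set R).
Proof.
apply/trivIsetP => k k' _ _ /eqP kk'; rewrite -subset0 => t [].
rewrite !cell_shift; case E: select => [nz|//]; case E': select => [nz'|//] /=.
rewrite !in_itv/= => h h'; apply: kk'; apply: select_inj (E) (E') _.
(* The image cells meet in [x], so the original cells meet in [V x]. *)
have [x [ex ex']] := open_cells_disjoint h h'; exists (V x).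
have [_ sz _] := selectP E; have [_ sz' _] := selectP E'.
split; apply/esym.
  by apply/(label_step _ sz); rewrite VK.
by apply/(label_step _ sz'); rewrite VK.
Qed.

Lemma coord_in_open_cell x : ~ endpoint nu c l x -> (exists n, stay_ n x) ->
  exists k, `]cell_a k, cell_b k[%classic (Phi x).
Proof.
move=> ne /select_cover[k [[n z] [E /= lz]]]; exists k.
rewrite /= in_itv/= /cell_a /cell_b E /=.
by rewrite -(lo_eq nu cl lz) -(hi_eq nu mc ml cl lz) (coord_in_cell mc ml cl).
Qed.

Lemma coord_in_shifted_cell x : ~ endpoint nu c l x -> (exists n, stay_ n (V x)) ->
  exists k, [set u + cell_d k | u in `]cell_a k, cell_b k[%classic] (Phi x).
Proof.
move=> ne /select_cover[k [[n z] [E /= lz]]]; exists k.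
suff : [set u + cell_d k | u in `]cell_a k, cell_b k[%classic] (Phi x) by [].
rewrite cell_shift E /= in_itv/=.
have [/= _ sz _] := selectP E.
have {}lz : l n x = l n (U z) by rewrite -(VK x); apply/esym/label_step/esym.
by rewrite -(lo_eq nu cl lz) -(hi_eq nu mc ml cl lz) (coord_in_cell mc ml cl).
Qed.

(** The shift in [coord_step] depends on the point only through its cell. *)
Lemma coord_translation k x : `]cell_a k, cell_b k[%classic (Phi x) ->
  Phi (U x) = Phi x + cell_d k.
Proof.
rewrite /cell_a /cell_b /cell_d /=; case E: select => [[n z]|]; last first.
  by rewrite in_itv/= => /andP[u0 u1]; move: (lt_trans u0 u1); rewrite ltxx.
rewrite in_itv/= => /(coord_inside mc ml cl) lz.
have [/= _ sz _] := selectP E.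
have sx : stay_ n x by apply: label_stay sz.
rewrite (coord_step sx); congr (_ + (_ - _)); apply: (lo_eq nu cl) => //.
exact: label_fwd.
Qed.

End TranslationOnCells.

(** * Conjugacy *)

Section Conjugacy.
Context (R : realType) d (Z : measurableType d) (nu : probability Z R).
Context (U V : Z -> Z) (UK : cancel U V).
Context (mU : measurable_fun setT U) (mV : measurable_fun setT V).
Context (nuU : forall C : set Z, measurable C -> nu (U @^-1` C) = nu C).
Context (A : nat -> set Z) (mA : forall n, measurable (A n)).
Context (A_sep : forall x y, (forall n, A n x <-> A n y) -> x = y).
Context (Phi : Z -> measurableTypeR R) (Psi : measurableTypeR R -> Z).
Context (mPhi : measurable_fun setT Phi) (mPsi : measurable_fun setT Psi).
Context (Phi01 : forall x, 0 <= Phi x <= 1).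
Context (law : forall B : set (measurableTypeR R), measurable B ->
    nu (Phi @^-1` B) = lebesgue_measure (B `&` `[0, 1]%classic)).
Context (PhiK : nu [set x | Psi (Phi x) <> x] = 0%E).

(** Requiring the left inverse along the whole orbit makes the set invariant. *)
Let X0 : set Z := [set x | forall j,
  Psi (Phi (iter j U x)) = iter j U x /\ Psi (Phi (iter j V x)) = iter j V x].
(** This is the image of [X0] under [Phi], written through [Psi] so that measurability follows from
    preimages. *)
Let Y0 : set (measurableTypeR R) :=
  [set t | [/\ 0 <= t <= 1, X0 (Psi t) & Phi (Psi t) = t]].

(** The identity outside [Y0] keeps the complement invariant, as the equality in [invariant_full]
    demands. *)
Definition conjugate (t : R) : R :=
  if `[< Y0 t >] then Phi (U (Psi t)) else t.

Let mK : measurable [set x | Psi (Phi x) = x].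
Proof.
apply: (measurable_fun_eq mA A_sep); last exact: measurable_id.
exact: measurableT_comp mPsi mPhi.
Qed.

Let mX0 : measurable X0.
Proof.
apply: measurable_forall => j; apply: measurable_and.
  exact: measurable_iter mK.
exact: measurable_iter mK.
Qed.

Let mY0 : measurable Y0.
Proof.
rewrite (_ : Y0 = `[0, 1]%classic `&`
    [set t | X0 (Psi t) /\ Phi (Psi t) = t]); last first.
  by apply/seteqP; split => t; rewrite /Y0 /= in_itv/=;
    [move=> [? ? ?]|move=> [? []]].
apply: measurableI; first exact: measurable_itv.
apply: measurable_and.
  by have := mPsi measurableT mX0; rewrite setTI.
have mD : measurable_fun setT (fun t : measurableTypeR R => Phi (Psi t) - t).
  by apply: measurable_realfun.measurable_funB;
    [exact: measurableT_comp mPhi mPsi|exact: measurable_id].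
rewrite (_ : [set t | _] = setT `&` (fun t => Phi (Psi t) - t) @^-1` [set 0]).
  by apply: mD => //; exact: measurable_set1.
apply/seteqP; split => t /=; first by move=> ->; rewrite subrr.
by move=> [_ /eqP]; rewrite subr_eq0 => /eqP.
Qed.

Let X0U x : X0 (U x) <-> X0 x.
Proof.
split => h j; split.
- case: j => [|j]; last by rewrite iterSr; have [] := h j.
  by have [_] := h 1%N; rewrite /= UK.
- by have [_] := h j.+1; rewrite iterSr UK.
- by have [] := h j.+1; rewrite iterSr.
- case: j => [|j]; last by rewrite iterSr UK; have [] := h j.
  by have [] := h 1%N.
Qed.

Let X0K x : X0 x -> Psi (Phi x) = x.
Proof. by move=> h; have [] := h 0%N. Qed.

Let X0Y x : X0 x -> Y0 (Phi x).
Proof. by move=> Xx; split; rewrite ?X0K. Qed.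

Let X0_full : nu (~` X0) = 0%E.
Proof.
have nuV := measure_preserving_inverse UK mV nuU.
have mnK : measurable [set x | Psi (Phi x) <> x] by exact: measurable_not.
have mE W : measurable_fun setT W ->
    measurable [set x | exists j, Psi (Phi (iter j W x)) <> iter j W x].
  by move=> mW; apply: measurable_exists => j; exact: measurable_iter mnK.
have E0 W : measurable_fun setT W ->
    (forall C : set Z, measurable C -> nu (W @^-1` C) = nu C) ->
    nu.-negligible [set x | exists j, Psi (Phi (iter j W x)) <> iter j W x].
  move=> mW nuW; apply/negligibleP; first exact: mE.
  apply: null_exists => j; first exact: measurable_iter mnK.
  by rewrite -PhiK; exact: (measure_iter mW nuW j mnK).
apply: measure_negligible; first exact: measurableC.
apply: (negligibleS _ (negligibleU (E0 U mU nuU) (E0 V mV nuV))).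
by move=> x /existsNP[j /not_andP[]]; [left|right]; exists j.
Qed.

(** By the uniform law it is enough that the preimage under [Phi] misses [X0]. *)
Let Y0_full : lebesgue_measure (`[0, 1]%classic `\` Y0) = 0%E.
Proof.
have mI : measurable (`[0, 1]%classic : set (measurableTypeR R)).
  exact: measurable_itv.
rewrite -[X in lebesgue_measure X](@setIidl _ _ `[0, 1]%classic); last by move=> t [].
rewrite -law; last exact: measurableD.
apply: null_subset X0_full => //; last first.
- by move=> x [_ nY] Xx; apply: nY; exact: X0Y.
- exact: measurableC.
- by rewrite -[_ @^-1` _]setTI; apply: mPhi => //; exact: measurableD.
Qed.

Lemma conjugate_full : exists N : set (measurableTypeR R),
  [/\ measurable N, lebesgue_measure N = 0%E &
  forall t : R, 0 <= t <= 1 -> ~ N t ->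
     Phi (Psi t) = t /\ conjugate t = Phi (U (Psi t))].
Proof.
exists (`[0, 1]%classic `\` Y0); split.
- by apply: measurableD => //; exact: measurable_itv.
- exact: Y0_full.
- move=> t t01 nN; have Yt : Y0 t.
    by apply: contrapT => nY; apply: nN; split => //=; rewrite in_itv.
  by rewrite /conjugate asboolT//; case: Yt.
Qed.

Lemma conjugate_01 t : 0 <= t <= 1 -> 0 <= conjugate t <= 1.
Proof. by move=> t01; rewrite /conjugate; case: asboolP => // _; exact: Phi01. Qed.

Lemma measurable_conjugate :
  measurable_fun setT (conjugate : measurableTypeR R -> measurableTypeR R).
Proof.
apply: measurable_fun_ifT; last exact: measurable_id.
  apply: (@measurable_fun_bool _ _ _ _ true).
  rewrite setTI (_ : _ @^-1` _ = Y0)//.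
  by apply/seteqP; split => t /=; case: asboolP.
by apply: measurableT_comp mPhi _; exact: measurableT_comp mU mPsi.
Qed.

Lemma conjugate_equivalent : metrically_equivalent (Y := measurableTypeR R)
  [set: Z] nu U `[0, 1]%classic (@lebesgue_measure R) conjugate.
Proof.
have Y01 : Y0 `<=` `[0, 1]%classic by move=> t [+ _ _] /=; rewrite in_itv.
have conjE x : X0 x -> conjugate (Phi x) = Phi (U x).
  by move=> Xx; rewrite /conjugate asboolT ?X0K//; exact: X0Y.
have mI : measurable (`[0, 1]%classic : set (measurableTypeR R)).
  exact: measurable_itv.
exists X0, Y0, Phi, Psi; split; [split; split|split|split|split|split] => //.
- by rewrite setTD.
- by rewrite setTI; apply/seteqP; split => x /=; rewrite X0U.
- apply/seteqP; split => t /=.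
    move=> [_]; rewrite /conjugate; case: asboolP => //.
  move=> Yt; split; first exact: Y01.
  have [_ XP e] := Yt; rewrite -{1}e conjE//.
  by apply: X0Y; rewrite X0U.
- by move=> t [].
- by move=> x; rewrite inE; exact: X0K.
- by move=> t; rewrite inE => -[].
- exact: measurable_funTS.
- exact: measurable_funTS.
- move=> B mB BY; have e := law mB; rewrite (setIidl (subset_trans BY Y01)) in e.
  apply: etrans e.
  have mPB : measurable (Phi @^-1` B).
    by rewrite -[_ @^-1` _]setTI; exact: mPhi.
  (* [law] measures the whole preimage of [B]; its part outside [X0] is null. *)
  rewrite [RHS](measureDI nu mPB mX0) setIC -[LHS]add0e; congr (_ + _)%E.
  apply/esym/(null_subset _ _ _ X0_full) => [||x []//].
    exact: measurableD.
  exact: measurableC.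
- by move=> x Xx; rewrite conjE.
Qed.

End Conjugacy.

(** * Coding by balls and assembly of the interval exchange *)

Lemma standard_borel_separated (R : realType) d (Z : measurableType d) :
  standard_borel R Z ->
  exists (P : metricType R) (f : Z -> P) (g : P -> Z) (q : nat -> P),
    [/\ forall F : set_system P, ProperFilter F -> cauchy F ->
          exists p : P, F --> p,
        cancel f g /\ cancel g f,
        forall S : set Z, measurable S <-> <<s @open P >> (f @` S) &
        forall x k, exists i, ball (q i) k.+1%:R^-1 x].
Proof.
move=> [P [f [[complete [D cD dD]] [g fK gK] mf]]].
(* [f point] witnesses that [P] is nonempty. *)
have [q hq] := dense_sequence (f point) cD dD.
by exists P, f, g, q.
Qed.

Lemma measurable_separated_set1 d (Z : measurableType d) (A : nat -> set Z) :
  (forall n, measurable (A n)) ->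
  (forall x y, (forall n, A n x <-> A n y) -> x = y) ->
  forall x : Z, measurable [set x].
Proof.
move=> mA A_sep x; rewrite (_ : [set x] = [set y | forall n, A n y <-> A n x]).
  apply: measurable_forall => n; apply: measurable_iff; first exact: mA.
  exact: measurable_const.
by apply/seteqP; split => y /=; [move=> ->|move=> /A_sep].
Qed.

Lemma non_atomic_set1 (R : realType) d (Z : measurableType d)
    (nu : {measure set Z -> \bar R}) (x : Z) :
  non_atomic nu -> measurable [set x] -> nu [set x] = 0%E.
Proof.
move=> na m1; apply: contrapT => /eqP n0; apply: (na [set x]); split => //.
  by rewrite lt0e n0 measure_ge0.
move=> B mB Bx; have [Bx'|nBx] := pselect (B x).
  by right; congr (nu _); apply/seteqP; split => // _ ->.
left; rewrite (_ : B = set0) ?measure0// -subset0 => y By.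
by apply: nBx; rewrite -(Bx _ By).
Qed.

Section Coding.
Context (R : realType) d (Z : measurableType d) (nu : probability Z R).
Context (U V : Z -> Z) (UK : cancel U V) (VK : cancel V U).
Context (mU : measurable_fun setT U) (mV : measurable_fun setT V).
Context (nuU : forall C : set Z, measurable C -> nu (U @^-1` C) = nu C).
Context (hnu : non_atomic nu).
Context (P : metricType R) (f : Z -> P) (g : P -> Z) (q : nat -> P).
Context (complete : forall F : set_system P, ProperFilter F -> cauchy F ->
          exists p : P, F --> p).
Context (fK : cancel f g) (gK : cancel g f).
Context (mf : forall S : set Z, measurable S <-> <<s @open P >> (f @` S)).
Context (q_dense : forall x k, exists i, ball (q i) k.+1%:R^-1 x).

(** Preimages of countably many balls of all scales, indexed through [pickle]; an index that codes
    no pair gets the full set, which separates nothing. *)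
Let A n : set Z :=
  if unpickle n is Some (i, k) then [set z | ball (q i) k.+1%:R^-1 (f z)]
  else setT.

Let A_pickle i k : A (pickle (i, k)) = [set z | ball (q i) k.+1%:R^-1 (f z)].
Proof. by rewrite /A pickleK. Qed.

Let mA n : measurable (A n).
Proof.
rewrite /A; case: unpickle => [[i k]|]; last exact: measurableT.
apply/mf; apply: sub_gen_smallest.
rewrite (_ : f @` _ = ball (q i) k.+1%:R^-1); first exact: metric_ball_open.
apply/seteqP; split => [_ [z + <-]//|p bp].
by exists (g p); rewrite /= gK.
Qed.

Let A_sep x y : (forall n, A n x <-> A n y) -> x = y.
Proof.
move=> Axy; apply: (can_inj fK); apply: (@mdist_invS_eq _ _ _ _ 2) => k.
have [i ix] := q_dense (f x) k.
have : A (pickle (i, k)) y by apply/Axy; rewrite A_pickle.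
move: ix; rewrite A_pickle /= !ballEmdist/= => ix iy.
apply: (le_trans (metric_triangle _ (q i) _)); rewrite metric_sym.
by move: ix iy; set v := k.+1%:R^-1; lra.
Qed.

Let l := label U V A.
Let c := code U V A.
Let cl : forall n x y, (forall i, (i <= n)%N -> c i x = c i y) <-> l n x = l n y :=
  code_label UK VK A.
Let sep : forall x y, (forall n, l n x = l n y) -> x = y := label_sep UK VK A_sep.
Let ml : forall n, measurable_fibers (l n) :=
  measurable_fibers_label UK VK mU mV mA A_sep.
Let mc : forall n, measurable_fibers (c n) :=
  measurable_fibers_code UK VK mU mV mA A_sep.
Let m1 := measurable_separated_set1 mA A_sep.
Let nu1 x := non_atomic_set1 hnu (m1 x).

Local Notation Phi := (coord nu c : Z -> measurableTypeR R).
Local Notation bad := (endpoint nu c l).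

(** The label at stage [pickle (i, k)] decides membership in the ball it codes. Off endpoints, the
    intervals containing [Phi x] therefore name exactly the balls containing [f x], and
    [borel_limit] recovers [f x]. *)
Lemma coord_left_inverse : exists Psi : measurableTypeR R -> Z,
  measurable_fun setT Psi /\ nu [set x | Psi (Phi x) <> x] = 0%E.
Proof.
pose E (i k : nat) (t : measurableTypeR R) :=
  cell_union nu c l (pickle (i, k)) (A (pickle (i, k))) t.
have mE i k : measurable [set t | E i k t] by exact: measurable_cell_union.
have [psi [mpsi psiE]] := borel_limit q complete mE (f point).
have mPsi : measurable_fun setT (fun t : measurableTypeR R => g (psi t)).
  move=> _ S /mf/mpsi; rewrite setTI; congr (measurable _).
  apply/seteqP; split => t /=; first by move=> [z Sz <-]; rewrite fK.
  by move=> Sg; exists (g (psi t)).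
exists (fun t => g (psi t)); split => //.
have [mPhi _] := coord_uniform mc ml cl sep m1 nu1.
apply: (null_subset _ _ _ (endpoint_null mc ml cl sep m1 nu1)).
- apply: measurable_not; apply: (measurable_fun_eq mA A_sep).
    exact: measurableT_comp mPsi mPhi.
  exact: measurable_id.
- exact: measurable_endpoint.
- move=> x /= ne; apply: contrapT => nb; apply: ne.
  rewrite (psiE _ (f x)) ?fK// => i k.
  rewrite /E (cell_unionE mc ml cl) ?A_pickle//.
  by move=> y z /(label_split UK VK)[_]; rewrite A_pickle => ->.
Qed.

Lemma isomorphic_countable_iet : exists T : R -> R,
  countable_iet T /\
  metrically_equivalent (Y := measurableTypeR R) [set: Z] nu U
    `[0, 1]%classic (@lebesgue_measure R) T.
Proof.
have [Psi [mPsi PhiK]] := coord_left_inverse.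
have [mPhi law] := coord_uniform mc ml cl sep m1 nu1.
have Phi01 := coord01 nu mc.
exists (conjugate U V Phi Psi); split; last first.
  exact: (conjugate_equivalent UK mU mV nuU mA A_sep mPhi mPsi Phi01 law PhiK).
have [N [mN N0 NE]] :=
  conjugate_full UK mU mV nuU mA A_sep mPhi mPsi Phi01 law PhiK.
split.
- move=> t /=; rewrite !in_itv/=; exact: conjugate_01.
- apply: measurable_funTS.
  exact: (measurable_conjugate mU mV mA A_sep mPhi mPsi).
pose a := cell_a nu U V A; pose b := cell_b nu U V A; pose dd := cell_d nu U V A.
exists a, b, dd; move=> Ui Vi.
have Ui01 m : Ui m `<=` (`[0, 1]%classic : set R).
  rewrite /Ui /a /b /cell_a /cell_b; case: select => [nz|].
    exact: open_cell01.
  move=> t /=; rewrite in_itv/= => /andP[t0 t1].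
  by move: (lt_trans t0 t1); rewrite ltxx.
have ViE m := cell_shift UK VK mU mV nuU mA A_sep m.
have Vi01 m : Vi m `<=` (`[0, 1]%classic : set R).
  rewrite /Vi /Ui ViE; case: select => [nz|//].
  exact: open_cell01.
pose S := [set x | forall n, ~ stay U V (marker U V A n) x].
have mS : measurable S.
  by apply: measurable_forall => n; apply: measurable_not; exact: measurable_stay.
have S0 : nu S = 0%E by exact: never_stay_null.
have mb := measurable_endpoint mc ml cl sep m1 nu1.
have b0 := endpoint_null mc ml cl sep m1 nu1.
have mI : measurable (`[0, 1]%classic : set (measurableTypeR R)).
  exact: measurable_itv.
have mUi m : measurable (Ui m : set (measurableTypeR R)) by exact: measurable_itv.
have mVi m : measurable (Vi m : set (measurableTypeR R)).
  by rewrite /Vi /Ui ViE; case: select => [nz|//]; exact: measurable_itv.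
split.
- by [].
- by split; [exact: trivIset_cells|exact: trivIset_shifted_cells].
(* Coordinates outside all the intervals come from endpoints or from points at which [U] never
   stays. *)
- apply: (lebesgue_null_image mc ml cl sep m1 nu1 (N := [set x | bad x] `|` S)).
  + by apply: measurableD => //; exact: bigcupT_measurable.
  + by move=> t [].
  + exact: measurableU.
  + apply: measure_negligible; first exact: measurableU.
    by apply: negligibleU; exact/negligibleP.
  + move=> x [_ nU]; apply: contrapT => /not_orP[nb nS]; apply: nU.
    have [|m Um] := coord_in_open_cell UK VK mU mV mA A_sep nb; last by exists m.
    by apply: contrapT => nst; apply: nS => n sn; apply: nst; exists n.
- have mVS : measurable (V @^-1` S) by rewrite -[_ @^-1` _]setTI; exact: mV.
  (* A point lies in a shifted interval through the cell of its predecessor, hence the preimage of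
     [S] under [V]. *)
  apply: (lebesgue_null_image mc ml cl sep m1 nu1 (N := [set x | bad x] `|` V @^-1` S)).
  + by apply: measurableD => //; exact: bigcupT_measurable.
  + by move=> t [].
  + exact: measurableU.
  + apply: measure_negligible; first exact: measurableU.
    apply: negligibleU; apply/negligibleP => //.
    exact: etrans (measure_preserving_inverse UK mV nuU mS) S0.
  + move=> x [_ nU]; apply: contrapT => /not_orP[nb nS]; apply: nU.
    have [|m Um] := coord_in_shifted_cell UK VK mU mV nuU mA A_sep nb; last by exists m.
    by apply: contrapT => nst; apply: nS => n sn; apply: nst; exists n.
- move=> m; exists N; split => // t /= nt; apply: contrapT => nN; apply: nt => Ut.
  have /= := Ui01 m t Ut; rewrite in_itv/= => t01.
  have [e ->] := NE t t01 nN.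
  (* Off [N], [t] is the coordinate of [Psi t], so the translation of coordinates applies at that
     point. *)
  have := @coord_translation _ _ _ nu _ _ UK VK mU mV nuU A mA A_sep m (Psi t).
  by rewrite e; apply.
Qed.

End Coding.

Theorem theorem3p10 (R : realType) (d : measure_display)
    (Z : measurableType d) (nu : probability Z R) (U : Z -> Z)
    (hZ : standard_borel R Z)
    (hnu : non_atomic nu)
    (hU : automorphism nu U) :
  exists T : R -> R,
    countable_iet T /\
    metrically_equivalent (Y := measurableTypeR R) [set: Z] nu U
        `[0, 1]%classic (@lebesgue_measure R) T.
Proof.
have [mU [V [UK VK mV]] nuU] := hU.
have [P [f [g [q [complete [fK gK] mf q_dense]]]]] := standard_borel_separated hZ.
exact: (isomorphic_countable_iet UK VK mU mV nuU hnu complete fK gK mf q_dense).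
Qed.
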